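(* Let $\Omega\subset\mathbb{R}^n$, $\Gamma$, $\Omega^\pm$, $\beta$ and the unit normal $\mathbf{n}$ be as in the context. Given $f\in L^2(\Omega)$ and $b\in H^1_0(\Omega)$, there exists a unique $u\in H^1_0(\Omega)$ such that $$-\int_\Omega\beta\nabla u\cdot\nabla\psi=\int_\Omega f\psi+\int_{\Omega^-}\nabla\cdot(b\psi\,\mathbf{n})$$ for all $\psi\in H^1_0(\Omega)$. (That is, there is a unique weak solution in $H^1_0(\Omega)$ of $\nabla\cdot(\beta\nabla u)=f$ in $\Omega\setminus\Gamma$, $[u]_\Gamma=0$ and $[\mathbf{n}\cdot\beta\nabla u]_\Gamma=b$ on $\Gamma$, $u=0$ on $\partial\Omega$.)
   Context: $\Omega\subset\mathbb{R}^n$ is a bounded domain with smooth boundary. $\Gamma\subset\Omega$ is a smooth hypersurface, the zero level set of a smooth function $\phi$ which near $\Gamma$ is the signed distance function to $\Gamma$. $\Omega^-=\{\phi<0\}$, $\Omega^+=\{\phi>0\}$, $\partial\Omega^-=\Gamma$, $\Omega=\Omega^+\cup\Omega^-\cup\Gamma$ (disjoint union). $\mathbf{n}=\nabla\phi/|\nabla\phi|$ on $\Gamma$ is the unit normal pointing from $\Omega^-$ to $\Omega^+$; in volume integrals over $\Omega^-$, $\mathbf{n}$ denotes a $C^1$ extension of this normal field to $\overline{\Omega^-}$ (the value of the integral $\int_{\Omega^-}\nabla\cdot(b\psi\,\mathbf{n})=\int_\Gamma b\psi\,ds$ does not depend on the extension). $\beta(x)$ is a symmetric positive definite $n\times n$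 matrix whose entries are $C^1$ on the closure of each of $\Omega^-$ and $\Omega^+$ (possibly discontinuous across $\Gamma$, where $\beta$ takes the limiting values from $\Omega^-$), with $m\,\mathrm{Id}\le\beta(x)\le M\,\mathrm{Id}$ for constants $0<m<M$. $[w]_\Gamma=w^+-w^-$ is the jump across $\Gamma$, with $w^\pm$ the limits from $\Omega^\pm$. *)

(* Defs.v *)
From HB Require Import structures.
From mathcomp Require Import all_boot all_order all_algebra.
From mathcomp Require Import all_classical all_reals all_analysis.

Set Implicit Arguments.
Unset Strict Implicit.
Unset Printing Implicit Defensive.

Import Order.TTheory GRing.Theory Num.Theory.
Import numFieldNormedType.Exports.

Local Open Scope classical_set_scope.
Local Open Scope ring_scope.

(* The product sigma-algebra on R^n, generated by the coordinate maps, as the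
   library does for tuples; it coincides with the Borel sigma-algebra. *)
Section measurable_rV.
Variables (R : realType) (n : nat).

Let coord (i : 'I_n) (v : 'rV[R]_n) : R := v ord0 i.

Let rV_set0 : g_sigma_preimage coord set0.
Proof. exact: sigma_algebra0. Qed.

Let rV_setC A : g_sigma_preimage coord A -> g_sigma_preimage coord (~` A).
Proof. exact: sigma_algebraC. Qed.

Let rV_bigcup (F : (set 'rV[R]_n)^nat) :
  (forall i, g_sigma_preimage coord (F i)) ->
  g_sigma_preimage coord (\bigcup_i (F i)).
Proof. exact: sigma_algebra_bigcup. Qed.

HB.instance Definition _ := @isMeasurable.Build default_measure_display
  'rV[R]_n (g_sigma_preimage coord) rV_set0 rV_setC rV_bigcup.

End measurable_rV.

Lemma measurable_rV_coord (R : realType) n (i : 'I_n) :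
  measurable_fun [set: 'rV[R]_n] (fun v : 'rV[R]_n => v ord0 i).
Proof.
move=> _ Y mY; rewrite setTI; apply: sub_sigma_algebra => /=.
rewrite -bigcup_seq/=; exists i => /=; first by rewrite mem_index_enum.
by exists Y => //; rewrite setTI.
Qed.

Lemma measurable_fun_rVP d (T : measurableType d) (R : realType) n
    (f : T -> 'rV[R]_n) :
  (forall i, measurable_fun [set: T] (fun x => f x ord0 i)) ->
  measurable_fun [set: T] f.
Proof.
move=> mf _ Y mY; rewrite setTI.
suff : measurable `<=` [set B : set 'rV[R]_n | measurable (f @^-1` B)] by exact.
apply: smallest_sub => [|B /=].
  split=> /= [|B mB|B mB]; first by rewrite preimage_set0.
    by rewrite setTD -preimage_setC; exact: measurableC.
  by rewrite preimage_bigcup; exact: bigcup_measurable.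
rewrite -bigcup_seq/= => -[i _ [C mC <-]].
by rewrite setTI -[X in measurable X]setTI; exact: mf.
Qed.

Section lebesgue_rV_step.
Variables (R : realType) (n : nat).

Definition rVcons (p : measurableTypeR R * 'rV[R]_n) : 'rV[R]_n.+1 :=
  \row_i (if unlift ord0 i is Some j then p.2 ord0 j else p.1).

Definition rVuncons (v : 'rV[R]_n.+1) : measurableTypeR R * 'rV[R]_n :=
  (v ord0 ord0, \row_j v ord0 (lift ord0 j)).

Lemma rVconsK : cancel rVcons rVuncons.
Proof.
case=> x v; rewrite /rVuncons !mxE/= unlift_none; congr pair.
by apply/rowP => j; rewrite !mxE liftK.
Qed.

Lemma rVunconsK : cancel rVuncons rVcons.
Proof.
by move=> v; apply/rowP => i; rewrite mxE; case: unliftP => [j|] ->; rewrite ?mxE.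
Qed.

Lemma measurable_rVcons : measurable_fun setT rVcons.
Proof.
apply: measurable_fun_rVP => i.
case: (unliftP ord0 i) => [j|] ->.
- rewrite (_ : (fun _ => _) = (fun v : 'rV[R]_n => v ord0 j) \o snd).
    by apply: measurableT_comp => //; exact: measurable_rV_coord.
  by apply/funext => p /=; rewrite mxE liftK.
- rewrite (_ : (fun _ => _) = fst)//.
  by apply/funext => p /=; rewrite mxE unlift_none.
Qed.

Lemma measurable_rVuncons : measurable_fun setT rVuncons.
Proof.
apply: measurable_fun_pair; first exact: measurable_rV_coord.
apply: measurable_fun_rVP => i.
rewrite (_ : (fun _ => _) = fun v : 'rV[R]_n.+1 => v ord0 (lift ord0 i)).
  exact: measurable_rV_coord.
by apply/funext => p; rewrite mxE.
Qed.

Variable mu : {sigma_finite_measure set 'rV[R]_n -> \bar R}.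

Definition lebesgue_rV_step : set 'rV[R]_n.+1 -> \bar R :=
  pushforward (lebesgue_measure \x mu)%E rVcons.

Let step0 : lebesgue_rV_step set0 = 0%E.
Proof. by rewrite /lebesgue_rV_step /pushforward preimage_set0 measure0. Qed.

Let step_ge0 A : (0 <= lebesgue_rV_step A)%E.
Proof. by rewrite /lebesgue_rV_step /pushforward; exact: measure_ge0. Qed.

Let step_sigma_additive : semi_sigma_additive lebesgue_rV_step.
Proof.
move=> F mF tF mUF; rewrite /lebesgue_rV_step /pushforward preimage_bigcup.
apply: measure_semi_sigma_additive.
- by move=> i; rewrite -[X in measurable X]setTI; exact: measurable_rVcons.
- apply/trivIsetP => /= i j _ _ ij; rewrite -preimage_setI.
  by move/trivIsetP : tF => /(_ _ _ _ _ ij) ->//; rewrite preimage_set0.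
- rewrite -preimage_bigcup -[X in measurable X]setTI.
  exact: measurable_rVcons.
Qed.

HB.instance Definition _ := isMeasure.Build _ _ _ lebesgue_rV_step
  step0 step_ge0 step_sigma_additive.

Let step_sigma_finite : sigma_finite setT lebesgue_rV_step.
Proof.
have /sigma_finiteP[F [TF ndF Foo]] := sigma_finiteT (@lebesgue_measure R).
have /sigma_finiteP[G [TG ndG Goo]] := sigma_finiteT mu.
exists (fun k => rVuncons @^-1` (F k `*` G k)).
  apply/esym; rewrite -subTset => v _.
  have [k _ Fk] : (\bigcup_k F k) (rVuncons v).1 by rewrite -TF.
  have [l _ Gl] : (\bigcup_k G k) (rVuncons v).2 by rewrite -TG.
  exists (maxn k l) => //; split.
  - by move: Fk; exact/subsetPset/ndF/leq_maxl.
  - by move: Gl; exact/subsetPset/ndG/leq_maxr.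
move=> k; have [mF Fk] := Foo k; have [mG Gk] := Goo k; split.
  rewrite -[X in measurable X]setTI; apply: measurable_rVuncons => //.
  exact: measurableX.
rewrite /lebesgue_rV_step /pushforward -comp_preimage.
rewrite (_ : rVuncons \o rVcons = id); last first.
  by apply/funext => p; exact: rVconsK.
rewrite preimage_id product_measure1E//.
by rewrite lte_mul_pinfty// ge0_fin_numE.
Qed.

HB.instance Definition _ := Measure_isSigmaFinite.Build _ _ _
  lebesgue_rV_step step_sigma_finite.

End lebesgue_rV_step.

Fixpoint lebesgue_rV (R : realType) (n : nat) :
    {sigma_finite_measure set 'rV[R]_n -> \bar R} :=
  match n with
  | 0 => \d_(0 : 'rV[R]_0)
  | n'.+1 => lebesgue_rV_step (lebesgue_rV R n')
  end.

Lemma lebesgue_rV_box (R : realType) (n : nat)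
    (A : 'I_n -> set (measurableTypeR R)) :
  (forall i, measurable (A i)) ->
  lebesgue_rV R n [set v | forall i, A i (v ord0 i)] =
    (\prod_(i < n) lebesgue_measure (A i))%E.
Proof.
elim: n A => [|n IHn] A mA.
  rewrite big_ord0 -[RHS](@diracT _ 'rV[R]_0 R 0).
  by congr dirac; apply/seteqP; split => // v _ [].
rewrite big_ord_recl -(IHn (fun j => A (lift ord0 j)))//.
rewrite /= /lebesgue_rV_step /pushforward.
rewrite -(@product_measure1E _ _ _ _ _ lebesgue_measure (lebesgue_rV R n)).
- congr (product_measure1 _ _ _); apply/seteqP; split => -[x v] /=.
  + move=> Av; split => [|i].
      by have := Av ord0; rewrite mxE unlift_none.
    by have := Av (lift ord0 i); rewrite mxE liftK.
  + by move=> -[Ax Av] i; rewrite mxE; case: unliftP => [j ->|->] //=.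
- exact: mA.
- have mB (i : 'I_n) : measurable
      ((fun v : 'rV[R]_n => v ord0 i) @^-1` A (lift ord0 i)).
    rewrite -[X in measurable X]setTI.
    exact: (@measurable_rV_coord R n i measurableT _ (mA (lift ord0 i))).
  have := fin_bigcap_measurable (@finite_finset _ setT) (fun i _ => mB i).
  congr measurable; apply/seteqP; split => v /= Av i; last by move=> _; exact: Av.
  exact: Av.
Qed.

Section classical_calculus.
Variables (R : realType) (n : nat).
Implicit Types (x y u v : 'rV[R]_n) (A B : 'M[R]_n) (U D G : set 'rV[R]_n)
  (f : 'rV[R]_n -> R).

Definition dotv u v : R := (u *m v^T) ord0 ord0.

(* The library norm on matrices is the sup norm, hence this definition. *)
Definition enorm u : R := Num.sqrt (dotv u u).

(* A acting on vectors, which are row vectors here *)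
Definition actv A v : 'rV[R]_n := (A *m v^T)^T.

Definition sym_posdef A :=
  A^T = A /\ forall v, v != 0 -> 0 < dotv (actv A v) v.

Definition loewner_le A B :=
  forall v, dotv (actv A v) v <= dotv (actv B v) v.

Definition bdry D : set 'rV[R]_n := closure D `\` interior D.

Definition eucl_dist x G : R := inf [set enorm (x - y) | y in G].

(* signed distance to G, negative in D *)
Definition signed_dist G D x : R :=
  if x \in D then - eucl_dist x G else eucl_dist x G.

Definition partial (i : 'I_n) f : 'rV[R]_n -> R := 'D_(delta_mx ord0 i) f.

Definition grad f x : 'rV[R]_n := \row_i partial i f x.

Fixpoint Ck (k : nat) U f : Prop :=
  (forall x, U x -> {for x, continuous f}) /\
  if k is k'.+1 then
    forall i, (forall x, U x -> derivable f x (delta_mx ord0 i)) /\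
              Ck k' U (partial i f)
  else True.

Definition smooth U f := forall k, Ck k U f.

Definition extends_continuously D f :=
  exists g : 'rV[R]_n -> R,
    {within closure D, continuous g} /\ forall x, D x -> g x = f x.

(* C^1 on the closure of the open set D; the values of f outside D,
   in particular on its boundary, are irrelevant. *)
Definition C1_closure D f :=
  [/\ Ck 1 D f, extends_continuously D f &
      forall i, extends_continuously D (partial i f)].

Definition smooth_hypersurface G :=
  forall x, G x -> exists U (rho : 'rV[R]_n -> R),
    [/\ open U, U x, smooth U rho, forall y, U y -> grad rho y != 0 &
        G `&` U = [set y | U y /\ rho y = 0]].

Definition smooth_boundary D :=
  forall x, bdry D x -> exists U (rho : 'rV[R]_n -> R),
    [/\ open U, U x, smooth U rho, forall y, U y -> grad rho y != 0 &
        D `&` U = [set y | U y /\ rho y < 0]].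

Definition bounded_smooth_domain D :=
  [/\ D !=set0, open D, connected D, bounded_set D & smooth_boundary D].

Definition neg_part D f : set 'rV[R]_n := [set x | D x /\ f x < 0].
Definition pos_part D f : set 'rV[R]_n := [set x | D x /\ 0 < f x].
Definition zero_part D f : set 'rV[R]_n := [set x | D x /\ f x = 0].

End classical_calculus.

(* Square-integrable and Sobolev functions are honest functions on R^n of which
   only the values in D matter; they are identified up to equality almost
   everywhere in D. *)
Section sobolev.
Variables (R : realType) (n : nat).
Implicit Types (D : set 'rV[R]_n) (u v g : 'rV[R]_n -> R).
Local Notation leb := (lebesgue_rV R n).

Definition L2 D u := u \_ D \in Lfun leb 2%:E.

Definition locally_integrable_on D u :=
  measurable_fun D u /\
  forall K, K `<=` D -> compact K -> (\int[leb]_(x in K) `|u x|%:E < +oo)%E.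

(* C_c^oo(D) *)
Definition test_function D u :=
  smooth setT u /\
  exists K, [/\ compact K, K `<=` D & forall x, ~ K x -> u x = 0].

Definition is_weak_partial D (i : 'I_n) u g :=
  [/\ locally_integrable_on D u, locally_integrable_on D g &
      forall v, test_function D v ->
        \int[leb]_(x in D) (u x * partial i v x) =
        - \int[leb]_(x in D) (g x * v x)].

(* Weak partial derivatives are unique up to equality almost everywhere in D;
   this picks one of them if there is any, and 0 otherwise. *)
Definition weak_partial D (i : 'I_n) u : 'rV[R]_n -> R :=
  xget (cst 0) [set g | is_weak_partial D i u g].

Definition weak_grad D u (x : 'rV[R]_n) : 'rV[R]_n :=
  \row_i weak_partial D i u x.

Definition weak_div D (F : 'rV[R]_n -> 'rV[R]_n) (x : 'rV[R]_n) : R :=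
  \sum_(i < n) weak_partial D i (fun y => F y ord0 i) x.

Definition H1 D u :=
  L2 D u /\ forall i, exists2 g, is_weak_partial D i u g & L2 D g.

Definition H1_norm D u : R :=
  Num.sqrt (\int[leb]_(x in D) (u x ^+ 2) +
            \sum_(i < n) \int[leb]_(x in D) (weak_partial D i u x ^+ 2)).

(* the closure of C_c^oo(D) in H^1(D) *)
Definition H10 D u :=
  H1 D u /\
  forall e : R, 0 < e -> exists2 v, test_function D v & H1_norm D (u \- v) < e.

Definition weak_solution (Om Omm : set 'rV[R]_n) (beta : 'rV[R]_n -> 'M[R]_n)
    (N : 'rV[R]_n -> 'rV[R]_n) (f b u : 'rV[R]_n -> R) :=
  H10 Om u /\
  forall psi : 'rV[R]_n -> R, H10 Om psi ->
    - (\int[leb]_(x in Om)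
         dotv (actv (beta x) (weak_grad Om u x)) (weak_grad Om psi x)) =
    (\int[leb]_(x in Om) (f x * psi x)) +
    (\int[leb]_(x in Omm) weak_div Omm (fun y => (b y * psi y) *: N y) x).

End sobolev.

(* Main.v *)
Require Import Defs.
From mathcomp Require Import all_boot all_order all_algebra.
From mathcomp Require Import all_classical all_reals all_analysis.
From mathcomp Require Import measurable_realfun.
From mathcomp Require Import ring lra.

(* The equation says that the energy form [a(u, psi) = int beta grad u . grad psi]
   equals a functional [<psi, p> + sum_i <d_i psi, q_i>] with square-integrable
   [p] and [q_i].  For the interface term this is the product rule: [b psi n_i]
   has the weak partial derivative
   [(d_i b psi + b d_i psi) n_i + b psi d_i n_i] in [Omm], and [n_i], [d_i n_i]
   are bounded there.  The product rule is first known for test functions, by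
   Fubini and the fundamental theorem of calculus, and passes to H^1_0 by density
   in [b] and [psi] separately.  Taking [b = psi = u] and the coordinate function
   [x_i] as multiplier gives [int u^2 = - 2 int x_i u d_i u], hence the Poincare
   inequality and the coercivity of [a].  As [a] is symmetric, minimizing
   [a(u, u) - 2 L(u)] over H^1_0, which is complete by Riesz-Fischer, yields the
   solution; coercivity yields uniqueness.  Since [weak_partial] chooses an
   arbitrary weak derivative, everything rests on their uniqueness almost
   everywhere: a locally integrable function orthogonal to all test functions
   vanishes, because indicators of boxes are dominated limits of bump functions
   built from [exp(-1/x)]. *)

Set Implicit Arguments.
Unset Strict Implicit.
Unset Printing Implicit Defensive.

Import Order.TTheory GRing.Theory Num.Theory.
Import numFieldNormedType.Exports.

Local Open Scope classical_set_scope.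
Local Open Scope ring_scope.

(** * Square-integrable functions *)

(** The functions [b] and [psi] vanish on the boundary of [Om], not on that of [Omm], so the product
    rule cannot be integrated by parts inside [Omm]. Instead a test function [v] on [Omm] is
    absorbed into the multiplier: [n_i v], extended by zero, is C^1 on the whole space, and the
    integration by parts takes place in [Om]. Moreover [b psi] and its gradient are integrable but
    in general not square integrable, so density in H^1 cannot be applied to the product. It is
    applied to one factor at a time, while the other factor is part of the L^2 coefficients of a
    linear functional. Functions are not taken modulo null sets and [weak_partial] is a choice,
    hence linear only almost everywhere. Linearity is therefore stated for inner products, and the
    minimization runs over a bare set with an operation of linear combination. The measure of the
    interface is never computed: [beta] is controlled on the closure of [Omm], because its values on
    the interface are limits from [Omm]. *)

Lemma discriminant_le (R : realType) (p q r : R) : 0 <= p -> 0 <= r ->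
  (forall t : R, 0 <= p + 2 * t * q + t ^+ 2 * r) -> q ^+ 2 <= p * r.
Proof.
move=> p0 r0 H; have [r00|rn0] := eqVneq r 0.
  rewrite r00 mulr0; have [->|q0] := eqVneq q 0; first by rewrite expr0n.
  (* For [r = 0] the polynomial is affine in [t]; this [t] gives it the value -1. *)
  have := H (- (p + 1) / (2 * q)); rewrite r00 mulr0 addr0.
  have -> : 2 * (- (p + 1) / (2 * q)) * q = - (p + 1) by field.
  lra.
have rp : 0 < r by rewrite lt_neqAle eq_sym rn0.
have := H (- q / r); rewrite -(@pmulr_lge0 _ r)//.
have : q / r * r = q by rewrite divfK.
by rewrite mulNr; move: (q / r) => t; nra.
Qed.

Section square_integrable.
Context d (T : measurableType d) (R : realType) (mu : {measure set T -> \bar R}).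
Variables (D : set T) (mD : measurable D).
Implicit Types (f g u v w c : T -> R).

Definition rintegrable f := mu.-integrable D (EFin \o f).

Lemma rintegrable_measurable f : rintegrable f -> measurable_fun D f.
Proof. by move=> /(measurable_int mu)/measurable_EFinP. Qed.

Lemma rintegrableD f g : rintegrable f -> rintegrable g ->
  rintegrable (fun x => f x + g x).
Proof. by move=> fi gi; have := integrableD mD fi gi. Qed.

Lemma rintegrableZ k f : rintegrable f -> rintegrable (fun x => k * f x).
Proof. by move=> fi; have := integrableZl mD k fi. Qed.

Lemma rintegrable_le f g : measurable_fun D f ->
  (forall x, D x -> `|f x| <= g x) -> rintegrable g -> rintegrable f.
Proof.
move=> mf fg; apply: le_integrable => //; first exact/measurable_EFinP.
move=> x Dx /=; rewrite lee_fin (le_trans (fg _ Dx))//.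
by rewrite ger0_norm// (le_trans _ (fg _ Dx)).
Qed.

Lemma rintegrable_eq f g : (forall x, D x -> f x = g x) ->
  rintegrable f -> rintegrable g.
Proof. by move=> fg; apply: eq_integrable => // x /set_mem Dx /=; rewrite fg. Qed.

Lemma rintegrable_bounded c f C : measurable_fun D c ->
  (forall x, D x -> `|c x| <= C) -> rintegrable f ->
  rintegrable (fun x => c x * f x).
Proof.
move=> mc cC fi; apply: (@rintegrable_le _ (fun x => C * `|f x|)).
- by apply: measurable_funM => //; exact: rintegrable_measurable.
- by move=> x Dx; rewrite normrM ler_wpM2r// cC.
- by apply: rintegrableZ; exact: integrable_norm.
Qed.

Lemma ae_eq_Rintegral f g : measurable_fun D f -> measurable_fun D g ->
  f = g %[ae mu in D] -> \int[mu]_(x in D) f x = \int[mu]_(x in D) g x.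
Proof.
move=> mf mg fg; congr fine; apply: ae_eq_integral => //; try exact/measurable_EFinP.
by apply: filterS fg => x + Dx => /(_ Dx) ->.
Qed.

Lemma ae_eq_rintegrable f g : measurable_fun D g ->
  f = g %[ae mu in D] -> rintegrable f -> rintegrable g.
Proof.
move=> mg fg /integrableP[mf fi]; apply/integrableP; split.
  exact/measurable_EFinP.
rewrite -(@ae_eq_integral _ _ _ mu D _ (fun x => `|(f x)%:E|%E))//.
- exact: measurableT_comp.
- by apply: measurableT_comp => //; exact/measurable_EFinP.
- by apply: filterS fg => x + Dx => /(_ Dx) /= ->.
Qed.

Lemma rintegrable_sum (I : Type) (s : seq I) (f : I -> T -> R) :
  (forall i, rintegrable (f i)) -> rintegrable (fun x => \sum_(i <- s) f i x).
Proof.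
move=> fi; elim: s => [|i s IH].
  by apply: rintegrable_eq (integrable0 mu D) => x _; rewrite big_nil.
by apply: rintegrable_eq (rintegrableD (fi i) IH) => x _; rewrite big_cons.
Qed.

Lemma Rintegral_sum (I : Type) (s : seq I) (f : I -> T -> R) :
  (forall i, rintegrable (f i)) ->
  \int[mu]_(x in D) (\sum_(i <- s) f i x) = \sum_(i <- s) \int[mu]_(x in D) f i x.
Proof.
move=> fi; elim: s => [|i s IH].
  under eq_Rintegral do rewrite big_nil.
  by rewrite big_nil Rintegral_cst// mul0r.
have is_ := rintegrable_sum s fi.
rewrite big_cons -IH -RintegralD//; last exact: fi.
by apply: eq_Rintegral => x _; rewrite big_cons.
Qed.

Definition sqint u := measurable_fun D u /\ rintegrable (fun x => u x ^+ 2).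

Definition ip u v := \int[mu]_(x in D) (u x * v x).

Lemma sqintM u v : sqint u -> sqint v -> rintegrable (fun x => u x * v x).
Proof.
move=> [mu_ iu] [mv iv].
apply: (@rintegrable_le _ (fun x => u x ^+ 2 + v x ^+ 2)).
- exact: measurable_funM.
- move=> x _; rewrite ler_norml; apply/andP; split.
  + by have := sqr_ge0 (u x + v x); have := sqr_ge0 (u x); have := sqr_ge0 (v x); nra.
  + by have := sqr_ge0 (u x - v x); have := sqr_ge0 (u x); have := sqr_ge0 (v x); nra.
- exact: rintegrableD.
Qed.

Lemma sqintD u v : sqint u -> sqint v -> sqint (fun x => u x + v x).
Proof.
move=> [mu_ iu] [mv iv]; split; first exact: measurable_funD.
apply: (@rintegrable_le _ (fun x => 2 * (u x ^+ 2 + v x ^+ 2))).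
- by apply: measurable_funX; exact: measurable_funD.
- move=> x _; rewrite ger0_norm ?sqr_ge0//.
  by have := sqr_ge0 (u x - v x); nra.
- by apply: rintegrableZ; exact: rintegrableD.
Qed.

Lemma sqintM_bounded c u C : measurable_fun D c ->
  (forall x, D x -> `|c x| <= C) -> sqint u -> sqint (fun x => c x * u x).
Proof.
move=> mc cC [mu_ iu]; split; first exact: measurable_funM.
apply: (@rintegrable_eq (fun x => c x ^+ 2 * u x ^+ 2)).
  by move=> x _; rewrite exprMn.
apply: (@rintegrable_bounded _ _ (C ^+ 2)) => //; first exact: measurable_funX.
by move=> x Dx; rewrite normrX lerXn2r ?nnegrE// ?cC// (le_trans _ (cC _ Dx)).
Qed.

Lemma sqintZ k u : sqint u -> sqint (fun x => k * u x).
Proof. exact: (@sqintM_bounded (cst k) u `|k|). Qed.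

Lemma sqintB u v : sqint u -> sqint v -> sqint (fun x => u x - v x).
Proof.
move=> su sv; have := sqintD su (sqintZ (-1) sv).
by under [X in sqint X -> _]eq_fun do rewrite mulN1r.
Qed.

Lemma ae_eq_sqint u v : measurable_fun D v -> u = v %[ae mu in D] ->
  sqint u -> sqint v.
Proof.
move=> mv uv [mu_ iu]; split => //.
apply: ae_eq_rintegrable iu; first exact: measurable_funX.
by apply: filterS uv => x + Dx => /(_ Dx) ->.
Qed.

Lemma ae_eq_ip u u' v v' : sqint u -> sqint u' -> sqint v -> sqint v' ->
  u = u' %[ae mu in D] -> v = v' %[ae mu in D] -> ip u v = ip u' v'.
Proof.
move=> su su' sv sv' uu' vv'; apply: ae_eq_Rintegral.
- exact: rintegrable_measurable (sqintM su sv).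
- exact: rintegrable_measurable (sqintM su' sv').
- by apply: filterS2 uu' vv' => x + + Dx => /(_ Dx) -> /(_ Dx) ->.
Qed.

Lemma ipC u v : ip u v = ip v u.
Proof. by apply: eq_Rintegral => x _; rewrite mulrC. Qed.

Lemma ipDl u v w : sqint u -> sqint v -> sqint w ->
  ip (fun x => u x + v x) w = ip u w + ip v w.
Proof.
move=> su sv sw; rewrite /ip -RintegralD//; try exact: sqintM.
by apply: eq_Rintegral => x _; rewrite mulrDl.
Qed.

Lemma ipZl k u w : sqint u -> sqint w -> ip (fun x => k * u x) w = k * ip u w.
Proof.
move=> su sw; rewrite /ip -RintegralZl//; last exact: sqintM.
by apply: eq_Rintegral => x _; rewrite mulrA.
Qed.

Lemma ipBl u v w : sqint u -> sqint v -> sqint w ->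
  ip (fun x => u x - v x) w = ip u w - ip v w.
Proof.
move=> su sv sw; rewrite /ip -RintegralB//; try exact: sqintM.
by apply: eq_Rintegral => x _; rewrite mulrBl.
Qed.

Lemma ip_ge0 u : 0 <= ip u u.
Proof. by apply: Rintegral_ge0 => x _; rewrite -expr2 sqr_ge0. Qed.

(** Discriminant of the nonnegative polynomial [t] -> [ip (u + t v) (u + t v)]. *)
Lemma Cauchy_Schwarz_ip u v : sqint u -> sqint v ->
  ip u v ^+ 2 <= ip u u * ip v v.
Proof.
move=> su sv; apply: discriminant_le; try exact: ip_ge0.
move=> t; have := ip_ge0 (fun x => u x + t * v x).
have stv := sqintZ t sv; rewrite ipDl//; last exact: sqintD.
rewrite ![ip _ (fun x => _ + _)]ipC !ipDl// !ipZl//.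
rewrite ![ip _ (fun x => t * _)]ipC !ipZl// [ip v u]ipC.
by move: (ip u u) (ip u v) (ip v v) => p q r; lra.
Qed.

Lemma ipD2_le u v : sqint u -> sqint v ->
  ip (fun x => u x + v x) (fun x => u x + v x) <= 2 * (ip u u + ip v v).
Proof.
move=> su sv; have sd := sqintD su sv.
rewrite ipDl// ![ip _ (fun x => u x + v x)]ipC !ipDl// [ip v u]ipC.
have := ip_ge0 (fun x => u x - v x); have sb := sqintB su sv.
by rewrite ipBl// ![ip _ (fun x => u x - v x)]ipC !ipBl// [ip v u]ipC; lra.
Qed.

Lemma ip_eq0 u : sqint u -> ip u u = 0 -> u = cst 0 %[ae mu in D].
Proof.
move=> [mu_ iu] u0.
have mu2 : measurable_fun D (fun x => (u x ^+ 2)%:E).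
  by apply/measurable_EFinP; exact: measurable_funX.
have : (\int[mu]_(x in D) `|(u x ^+ 2)%:E|)%E = 0%E.
  under eq_integral do rewrite gee0_abs ?lee_fin ?sqr_ge0//.
  rewrite -(@fineK _ (\int[mu]_(x in D) (u x ^+ 2)%:E))%E; last exact: integrable_fin_num.
  by congr EFin.
move/(ae_eq_integral_abs mu mD mu2); apply: filterS => x + Dx => /(_ Dx) /= [].
by move=> /eqP; rewrite sqrf_eq0 => /eqP.
Qed.

(** The weights [2 ^+ k] turn square summability into absolute summability of the increments:
    [|s| <= 2^-k + 2^k s^2], and both terms on the right are summable. *)
Lemma cvg_of_summable_sqr (a : R^nat) :
  (\sum_(k <oo) (2 ^+ k * (a k.+1 - a k) ^+ 2)%:E < +oo)%E -> cvgn a.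
Proof.
move=> asum.
suff : cvgn (series (fun k => a k.+1 - a k)).
  move=> csum; have -> : a = (fun k => a 0%N + series (fun k => a k.+1 - a k) k).
    by apply/funext => k; rewrite seriesEnat /= telescope_sumr// addrCA subrr addr0.
  by apply: is_cvgD => //; exact: is_cvg_cst.
apply: normed_cvg.
have geo : cvgn (series (fun k => (2^-1 : R) ^+ k)).
  have := @is_cvg_geometric_series R 1 2^-1.
    rewrite ger0_norm ?invr_ge0// invf_lt1// ltr1n => /(_ isT).
    by congr (cvg (_ @ \oo)); congr series; apply/funext => k; rewrite /= mul1r.
have sq : cvgn (series (fun k => 2 ^+ k * (a k.+1 - a k) ^+ 2)).
  apply: nondecreasing_is_cvgn.
    by apply: nondecreasing_series => k _ _; rewrite mulr_ge0// ?sqr_ge0// exprn_ge0.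
  exists (fine (\sum_(k <oo) (2 ^+ k * (a k.+1 - a k) ^+ 2)%:E)%E) => _ [k _ <-].
  rewrite -lee_fin fineK; last first.
    rewrite ge0_fin_numE// nneseries_ge0// => n _ _.
    by rewrite lee_fin mulr_ge0// ?sqr_ge0// exprn_ge0.
  rewrite seriesEnat /= -sumEFin; apply: nneseries_lim_ge => n _ _.
  by rewrite lee_fin mulr_ge0// ?sqr_ge0// exprn_ge0.
apply: (@series_le_cvg _ _ (fun k => (2^-1) ^+ k + 2 ^+ k * (a k.+1 - a k) ^+ 2)).
- by move=> k; rewrite normr_ge0.
- by move=> k; apply: addr_ge0; [rewrite exprn_ge0 ?invr_ge0|rewrite mulr_ge0 ?sqr_ge0 ?exprn_ge0].
- move=> k; rewrite /= exprVn; set p : R := 2 ^+ k; set t := _ - _.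
  have p0 : 0 < p by rewrite exprn_gt0.
  rewrite -(@ler_pM2l _ p)// mulrDr divff ?gt_eqF//.
  rewrite -[t ^+ 2]real_normK ?num_real//; set s := `|t|.
  have s0 : 0 <= s by exact: normr_ge0.
  (* After multiplication by [p] the goal is [p s <= 1 + (p s)^2]. *)
  have := sqr_ge0 (p * s - 1); nra.
- by rewrite (_ : series _ = series (fun k => (2^-1 : R) ^+ k) +
      series (fun k => 2 ^+ k * (a k.+1 - a k) ^+ 2));
    [exact: is_cvgD|rewrite -seriesD].
Qed.

(** A subsequence [v] whose successive squared distances are at most [4^-j] makes the sum of
    [2^j (v_(j+1) - v_j)^2] have integral at most 2. This sum is then finite almost everywhere,
    which forces pointwise convergence there. Fatou's lemma along [v] with [k] fixed bounds the
    distance from [u k] to the limit, so the whole sequence converges at once. *)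
Lemma Riesz_Fischer (u : (T -> R)^nat) : (forall k, sqint (u k)) ->
  (forall e : R, 0 < e -> exists K, forall k l, (K <= k)%N -> (K <= l)%N ->
    ip (fun x => u k x - u l x) (fun x => u k x - u l x) <= e) ->
  exists2 w, sqint w & forall e : R, 0 < e -> exists K, forall k, (K <= k)%N ->
    ip (fun x => u k x - w x) (fun x => u k x - w x) <= e.
Proof.
move=> su cu.
have [s Hs] : exists s : nat -> nat, forall j k l, (s j <= k)%N -> (s j <= l)%N ->
    ip (fun x => u k x - u l x) (fun x => u k x - u l x) <= (4^-1) ^+ j.
  have : forall j : nat, exists K, forall k l, (K <= k)%N -> (K <= l)%N ->
     ip (fun x => u k x - u l x) (fun x => u k x - u l x) <= (4^-1) ^+ j.
    by move=> j; apply: cu; rewrite exprn_gt0// invr_gt0.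
  by move/choice => [s Hs]; exists s.
(* Making [t] strictly increasing gives both [s j <= t j], for the bound [4^-j], and [j <= t j], for
   the tails in Fatou's lemma. *)
pose t := fix t j := if j is j'.+1 then maxn (t j').+1 (s j) else s 0%N.
have ts j : (s j <= t j)%N by case: j => //= j; rewrite leq_maxr.
have tS j : (t j < t j.+1)%N by rewrite /= leq_maxl.
have jt j : (j <= t j)%N by elim: j => // j IH; rewrite (leq_ltn_trans IH).
pose v j := u (t j).
have sv j : sqint (v j) by exact: su.
have mv j : measurable_fun D (v j) by have [] := sv j.
pose q j x : R := 2 ^+ j * (v j.+1 x - v j x) ^+ 2.
have q0 j x : 0 <= q j x by rewrite mulr_ge0// ?sqr_ge0// exprn_ge0.
have mq j : measurable_fun D (fun x => (q j x)%:E).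
  apply/measurable_EFinP; apply: measurable_funM => //.
  by apply: measurable_funX; exact: measurable_funB.
have qle j : (\int[mu]_(x in D) (q j x)%:E <= ((2^-1) ^+ j)%:E)%E.
  have iq : rintegrable (q j) by apply: rintegrableZ; have [] := sqintB (sv j.+1) (sv j).
  rewrite -[leLHS]fineK; last exact: integrable_fin_num.
  rewrite lee_fin -[leLHS]/(\int[mu]_(x in D) q j x) /q RintegralZl//; last first.
    by have [] := sqintB (sv j.+1) (sv j).
  have h := Hs j (t j.+1) (t j) (leq_trans (ts j) (ltnW (tS j))) (ts j).
  apply: (@le_trans _ _ (2 ^+ j * (4^-1) ^+ j)).
    by rewrite ler_pM2l ?exprn_gt0.
  rewrite -exprMn; suff -> : 2 * 4^-1 = 2^-1 :> R by [].
  by field.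
have sumq : (\int[mu]_(x in D) (\sum_(j <oo) (q j x)%:E) < +oo)%E.
  rewrite integral_nneseries//; last by move=> j x _; rewrite lee_fin.
  apply: (@le_lt_trans _ _ (\sum_(j <oo) ((2^-1 : R) ^+ j)%:E)%E).
    by apply: lee_nneseries => // j _ _; apply: integral_ge0 => x _; rewrite lee_fin.
  have -> : (\sum_(j <oo) ((2^-1 : R) ^+ j)%:E = 2%:E)%E.
    have := @cvg_geometric_series R 1 2^-1.
    rewrite ger0_norm ?invr_ge0// invf_lt1// ltr1n => /(_ isT) h.
    apply/cvg_lim => //; rewrite (_ : (fun n => _) =
        EFin \o series (geometric 1 (2^-1 : R))).
      apply: cvg_EFin; first exact: nearW.
      apply: cvg_trans h _ => //.
      by rewrite (_ : 1 / _ = 2 :> R)//; field.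
    apply/funext => n /=; rewrite seriesEnat/= -sumEFin.
    by apply: eq_bigr => i _; rewrite mul1r.
  by rewrite ltry.
(* The upper limit is measurable everywhere and equals the limit where it exists; [fine] sends
   infinite values to 0. *)
pose w x := fine (limn_esup (fun j => (v j x)%:E)).
have mw : measurable_fun D w.
  apply: measurableT_comp => //; apply: measurable_fun_limn_esup => j.
  exact/measurable_EFinP.
have vw : \forall x \ae mu, D x -> v ^~ x @ \oo --> w x.
  have iq : mu.-integrable D (fun x => \sum_(j <oo) (q j x)%:E)%E.
    apply/integrableP; split.
      by apply: ge0_emeasurable_sum => // j x _ _; rewrite lee_fin.
    rewrite (eq_integral (fun x => \sum_(j <oo) (q j x)%:E)%E)// => x _.
    by rewrite gee0_abs// nneseries_ge0// => n _ _; rewrite lee_fin.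
  apply: filterS (integrable_ae mD iq) => x + Dx => /(_ Dx) qx.
  have cv : cvgn (v ^~ x).
    apply: cvg_of_summable_sqr.
    rewrite -ge0_fin_numE// nneseries_ge0// => n _ _.
    by rewrite lee_fin; exact: (q0 n x).
  suff -> : w x = limn (v ^~ x) by [].
  have h : (fun j => (v j x)%:E) @ \oo --> (limn (v ^~ x))%:E.
    by apply: cvg_EFin; [exact: nearW|exact: cv].
  by rewrite /w (is_cvg_limn_esupE (cvgP _ h)) (cvg_lim _ h).
have key e : 0 < e -> exists K, forall k, (K <= k)%N ->
    (\int[mu]_(x in D) ((u k x - w x) ^+ 2)%:E <= e%:E)%E.
  move=> e0; have [K HK] := cu _ e0; exists K => k Kk.
  pose h j x := ((u k x - v j x) ^+ 2)%:E.
  have mh j : measurable_fun D (h j).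
    apply/measurable_EFinP/measurable_funX/measurable_funB => //.
    by have [] := su k.
  have h0 j x : D x -> (0 <= h j x)%E by rewrite lee_fin sqr_ge0.
  have := fatou mu mD mh h0.
  rewrite (@ae_eq_integral _ _ _ mu D (fun x => ((u k x - w x) ^+ 2)%:E)
    (fun x => limn_einf (h ^~ x)) mD); last first.
  - apply: filterS vw => x + Dx => /(_ Dx) vx.
    have hx : h ^~ x @ \oo --> ((u k x - w x) ^+ 2)%:E.
      apply: cvg_EFin; first exact: nearW.
      rewrite /=; rewrite (_ : _ \o _ = (fun j => (u k x - v j x) * (u k x - v j x)))//.
      by apply: cvgM; apply: cvgB => //; exact: cvg_cst.
    by rewrite (is_cvg_limn_einfE (cvgP _ hx)); exact: cvg_lim.
  - apply/measurable_EFinP/measurable_funX/measurable_funB => //.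
    by have [] := su k.
  - rewrite (_ : (fun x => _) = (fun x => - limn_esup (fun j => - h j x))%E).
      apply/measurableT_comp => //; apply: measurable_fun_limn_esup => j.
      exact: measurableT_comp.
    apply/funext => x; rewrite -(limn_einfN (fun j => - h j x)%E).
    by congr limn_einf; apply/funext => j; rewrite /comp oppeK.
  move/le_trans; apply.
  rewrite limn_einf_lim; apply: lime_le; first exact: is_cvg_einfs.
  near=> j; apply: (@le_trans _ _ (\int[mu]_(x in D) h j x)%E).
    apply: ge_ereal_inf; exists (\int[mu]_(x in D) h j x)%E => //.
    by exists j => /=.
  have Kj : (K <= t j)%N by rewrite (leq_trans _ (jt j))//; near: j; exact: nbhs_infty_ge.
  have suv := sqintB (su k) (sv j).
  rewrite -[leLHS]fineK; last by apply: integrable_fin_num => //; have [] := suv.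
  by rewrite lee_fin; exact: HK.
(* Square integrability of [w] follows from that of [u K1 - w] for a single index. *)
have [K1 HK1] := key 1 ltr01.
have sw : sqint w.
  have : sqint (fun x => u K1 x - w x).
    split; first by apply: measurable_funB => //; have [] := su K1.
    apply/integrableP; split.
      by apply/measurable_EFinP/measurable_funX/measurable_funB => //; have [] := su K1.
    under eq_integral do rewrite gee0_abs ?lee_fin ?sqr_ge0//.
    exact: le_lt_trans (HK1 _ (leqnn _)) (ltry _).
  move/(sqintB (su K1)); congr sqint.
  by apply/funext => x; rewrite opprB addrC subrK.
exists w => // e e0; have [K HK] := key e e0; exists K => k /HK.
have suw := sqintB (su k) sw.
rewrite -lee_fin /ip /Rintegral fineK//.
exact/integrable_fin_num/sqintM.
Unshelve. all: by end_near. Qed.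

End square_integrable.

(** * Topology and measure of R^n *)

Section Rn_topology_measure.
Variables (R : realType) (n : nat).
Implicit Types (x y v : 'rV[R]_n) (A : 'I_n -> set R) (a b c e : 'I_n -> R).
Local Notation leb := (lebesgue_rV R n).

Definition box A : set 'rV[R]_n := [set v | forall i, A i (v ord0 i)].

Definition obox a b := box (fun i => `]a i, b i[%classic).

Definition cbox a b := box (fun i => `[a i, b i]%classic).

Lemma measurable_box A : (forall i, measurable (A i)) -> measurable (box A).
Proof.
move=> mA; have mB (i : 'I_n) : measurable ((fun v : 'rV[R]_n => v ord0 i) @^-1` A i).
  by rewrite -[X in measurable X]setTI; exact: measurable_rV_coord.
have := fin_bigcap_measurable (@finite_finset _ setT) (fun i _ => mB i).
by congr measurable; apply/seteqP; split => v /= Av i; [exact: Av|move=> _; exact: Av].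
Qed.

Lemma measurable_obox a b : measurable (obox a b).
Proof. by apply: measurable_box => i; exact: measurable_itv. Qed.

Lemma measurable_cbox a b : measurable (cbox a b).
Proof. by apply: measurable_box => i; exact: measurable_itv. Qed.

Lemma ler_norm_coord v i : `|v ord0 i| <= `|v|.
Proof.
have /mapP[j Hj ->] : `|v ord0 i| \in [seq `|v x.1 x.2| | x : 'I_1 * 'I_n].
  by apply/mapP; exists (ord0, i) => //=; rewrite mem_enum.
by rewrite [leRHS]/Num.norm /= mx_normrE; apply/bigmax_geP; right => /=; exists j.
Qed.

Lemma norm_rV_le v (r : R) : 0 <= r -> (forall i, `|v ord0 i| <= r) -> `|v| <= r.
Proof.
move=> r0 vr; rewrite [leLHS]/Num.norm /= mx_normrE; apply/bigmax_leP; split => //.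
by case=> i j _ /=; rewrite ord1.
Qed.

Lemma nbhs_rVP x (U : set 'rV[R]_n) : nbhs x U <->
  exists2 e : R, 0 < e & forall y, (forall i, `|y ord0 i - x ord0 i| < e) -> U y.
Proof.
split=> [/nbhs_ballP[e /= e0 eU]|[e e0 eU]].
  exists e => // y xy; apply: eU; split => // i j.
  by rewrite ord1 /ball /= distrC; exact: xy.
apply/nbhs_ballP; exists e => //= y [_ xy]; apply: eU => i.
by rewrite distrC; exact: xy.
Qed.

(** Boxes with rational centre and radius [1/(m+1)] are countable. The closed boxes are required to
    lie in [U] because they later serve as compact subsets on which locally integrable functions are
    integrable. *)
Lemma open_rV_bigcup_obox (U : set 'rV[R]_n) : open U ->
  exists (P : set nat) (a b : nat -> 'I_n -> R),
    (forall k, P k -> cbox (a k) (b k) `<=` U) /\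
    U = \bigcup_(k in P) obox (a k) (b k).
Proof.
move=> oU.
(* Naturals that encode nothing get centre 0 and [m = 0], a genuine box that is kept or dropped like
   any other. *)
pose d (k : nat) : 'rV[rat]_n * nat := odflt (0, 0%N) (unpickle k).
pose a k i : R := ratr ((d k).1 ord0 i) - (d k).2.+1%:R^-1.
pose b k i : R := ratr ((d k).1 ord0 i) + (d k).2.+1%:R^-1.
exists [set k | cbox (a k) (b k) `<=` U], a, b; split=> //.
apply/seteqP; split=> [x Ux|x [k /= kU xk]]; last first.
  by apply: kU => i; apply: subset_itv_oo_cc; exact: xk.
have /nbhs_rVP[e e0 eU] : nbhs x U by exact: open_nbhs_nbhs.
(* The centre is within the radius of [x], so points of the closed box are within twice the radius
   of [x], hence within [e]. *)
have [m me] : exists m : nat, m.+1%:R^-1 < e / 2.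
  have e20 : 0 < e / 2 by rewrite divr_gt0.
  exists (Num.trunc (e / 2)^-1).
  by rewrite invf_plt ?posrE// truncnS_gt.
have m0 : 0 < m.+1%:R^-1 :> R by rewrite invr_gt0.
have /choice[q Hq] : forall i, exists r : rat, ratr r \in
    `]x ord0 i - m.+1%:R^-1, x ord0 i + m.+1%:R^-1[.
  move=> i.
  have /rat_in_itvoo[r Hr] : x ord0 i - m.+1%:R^-1 < x ord0 i + m.+1%:R^-1.
    by rewrite ltrD2l gtrN.
  by exists r.
have near_q (X Y Q t : R) : t < e / 2 -> Q - t <= Y <= Q + t ->
    X - t < Q < X + t -> - e < Y - X < e.
  by move=> ? /andP[? ?] /andP[? ?]; apply/andP; split; lra.
have near_q' (X Q t : R) : X - t < Q < X + t -> Q - t < X < Q + t.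
  by move=> /andP[? ?]; apply/andP; split; lra.
exists (pickle (\row_i q i : 'rV[rat]_n, m)); rewrite /a /b /d /= pickleK /=.
  move=> y yq; apply: eU => i; move: (yq i) (Hq i).
  rewrite /= !in_itv/= mxE => yq' xq; rewrite ltr_norml; exact: near_q me yq' xq.
move=> i /=; rewrite mxE in_itv/=; move: (Hq i); rewrite in_itv/=; exact: near_q'.
Qed.

Lemma open_rV_measurable (U : set 'rV[R]_n) : open U -> measurable U.
Proof.
move=> /open_rV_bigcup_obox[P [a [b [_ ->]]]].
by apply: bigcup_measurable => k _; exact: measurable_obox.
Qed.

Lemma closed_rV_measurable (U : set 'rV[R]_n) : closed U -> measurable U.
Proof.
by move=> /closed_openC/open_rV_measurable/measurableC; rewrite setCK.
Qed.

Lemma within_continuous_measurable_rV (D : set 'rV[R]_n) (f : 'rV[R]_n -> R) :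
  measurable D -> {within D, continuous f} -> measurable_fun D f.
Proof.
move=> mD /continuousP cf; apply: (measurability _ (RGenOpens.measurableE R)).
move=> _ [_ [a [b ->] <-]].
have oab : open `]a, b[%classic by exact: interval_open.
have /open_subspaceP[V oV] := cf _ oab.
by rewrite setIC => VD; rewrite setIC -VD; apply: measurableI => //; exact: open_rV_measurable.
Qed.

Lemma continuous_measurable_rV (D : set 'rV[R]_n) (f : 'rV[R]_n -> R) :
  open D -> (forall x, D x -> {for x, continuous f}) -> measurable_fun D f.
Proof.
move=> oD cf; apply: within_continuous_measurable_rV.
  exact: open_rV_measurable.
by rewrite continuous_open_subspace// => x /set_mem; exact: cf.
Qed.

Lemma compact_rV_measurable (K : set 'rV[R]_n) : compact K -> measurable K.
Proof.
move=> cK; apply: closed_rV_measurable; apply: compact_closed cK.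
exact: norm_hausdorff.
Qed.

Lemma bounded_rV_norm (D : set 'rV[R]_n) : bounded_set D ->
  exists2 r : R, 0 < r & D `<=` [set v | `|v| <= r].
Proof.
move=> [M [_ HM]]; exists (`|M| + 1) => [|v Dv /=]; first by rewrite ltr_wpDl.
by apply: HM => //; rewrite ltr_pwDr// ler_norm.
Qed.

Lemma lebesgue_bounded_lty (D : set 'rV[R]_n) : bounded_set D -> measurable D ->
  (leb D < +oo)%E.
Proof.
move=> /bounded_rV_norm[r r0 Dr] mD.
have mc := measurable_cbox (fun=> - r) (fun=> r).
apply: (@le_lt_trans _ _ (leb (cbox (fun=> - r) (fun=> r)))).
  apply: le_measure; rewrite ?inE// => v /Dr /= vr i /=.
  by rewrite in_itv/= -ler_norml (le_trans (ler_norm_coord _ _)).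
have -> := @lebesgue_rV_box R n (fun=> `[- r, r]%classic) (fun i => measurable_itv _).
rewrite -ge0_fin_numE; last by apply: prode_ge0 => i _; exact: measure_ge0.
apply: prode_fin_num => i _; rewrite lebesgue_measure_itv/= lte_fin.
by case: ifPn.
Qed.

(** Open boxes are stable under intersection, as Dynkin's theorem requires, whereas the coordinate
    cylinders defining the sigma-algebra need not be. Open sets are countable unions of boxes, so
    the coordinates are measurable for the sigma-algebra of the boxes. *)
Lemma measurable_rV_obox_gen :
  @measurable _ 'rV[R]_n = <<s [set B | exists a b, B = obox a b] >>.
Proof.
set G := [set B | _]; apply/seteqP; split; last first.
  apply: smallest_sub; first exact: sigma_algebra_measurable.
  by move=> _ [a [b ->]]; exact: measurable_obox.
have oG (U : set 'rV[R]_n) : open U -> <<s G >> U.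
  move=> /open_rV_bigcup_obox[P [a [b [_ ->]]]].
  apply: (@bigcup_measurable _ (g_sigma_algebraType G)) => k _.
  by apply: sub_sigma_algebra; exists (a k), (b k).
pose T := g_sigma_algebraType G.
have mid : measurable_fun [set: T] (id : T -> 'rV[R]_n).
  apply: measurable_fun_rVP => i.
  apply: (measurability _ (RGenOpens.measurableE R)) => _ [_ [x [y ->] <-]].
  rewrite setTI; apply: oG; apply: open_comp => [v _|]; last exact: interval_open.
  exact: coord_continuous.
by move=> Y mY; have := mid measurableT Y mY; rewrite setTI.
Qed.

Lemma oboxI a b c e : obox a b `&` obox c e =
  obox (fun i => Num.max (a i) (c i)) (fun i => Num.min (b i) (e i)).
Proof.
apply/seteqP; split=> [v [ab ce] i|v h].
  have /= := ab i; have /= := ce i; rewrite !in_itv/= => /andP[? ?] /andP[? ?].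
  by rewrite gt_max lt_min; do 2 (apply/andP; split => //).
by split=> i; have /= := h i; rewrite !in_itv/= gt_max lt_min =>
  /andP[/andP[? ?] /andP[? ?]]; apply/andP.
Qed.

(** The sets [E] such that [g] has integral zero over the part of [E] in the box form a Dynkin
    system. By [oboxI] it contains all open boxes, and their intersections with the given box are
    among the boxes of the hypothesis. *)
Lemma ae_eq0_of_obox_integrals a b (g : 'rV[R]_n -> R) :
  rintegrable leb (obox a b) g ->
  (forall c e, (forall i, a i <= c i) -> (forall i, e i <= b i) ->
     (\int[leb]_(x in obox c e) (g x)%:E = 0)%E) ->
  g = cst 0 %[ae leb in obox a b].
Proof.
move=> gi g0; set Q := obox a b; have mQ : measurable Q by exact: measurable_obox.
have sub0 E : measurable E -> (\int[leb]_(x in E `&` Q) (g x)%:E = 0)%E.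
  rewrite measurable_rV_obox_gen; move: E.
  apply: (dynkin_induction measurable_rV_obox_gen
    (P := fun E => (\int[leb]_(x in E `&` Q) (g x)%:E = 0)%E)).
  - move=> _ _ [c [d ->]] [c' [d' ->]]; rewrite oboxI.
    by do 2 eexists.
  - by rewrite setTI; exact: g0.
  - move=> _ [c [d ->]]; rewrite oboxI; apply: g0 => i.
    + by rewrite le_max lexx orbT.
    + by rewrite ge_min lexx orbT.
  - move=> S mS S0; have := g0 a b (fun=> lexx _) (fun=> lexx _).
    have QE : Q = (S `&` Q) `|` (~` S `&` Q) by rewrite -setIUl setUv setTI.
    rewrite -/Q {1}QE integral_setU; last 4 first.
    + exact: measurableI.
    + by apply: measurableI => //; exact: measurableC.
    + by rewrite -QE; exact: measurable_int gi.
    + by apply/disj_set2P/seteqP; split=> x // [[Sx _] [nSx _]].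
    + by rewrite S0 add0e.
  - move=> F mF tF F0; rewrite setI_bigcupl integral_bigcup.
    + by rewrite eseries0.
    + exact: trivIset_setIr.
    + by move=> k; exact: measurableI.
    + apply: integrableS gi => //; last by move=> x [k _ []].
      by apply: bigcupT_measurable => k; exact: measurableI.
have := @integral_ae_eq _ _ _ leb Q mQ (cst 0%E) (EFin \o g) gi (measurable_cst _).
move=> h; have : ae_eq leb Q (EFin \o g) (cst 0%E).
  apply: h => E EQ mE; rewrite integral0 -(sub0 E mE).
  by rewrite setIidl.
by apply: filterS => x + Qx => /(_ Qx) [].
Qed.

End Rn_topology_measure.

(** * Integrals of partial derivatives *)

Lemma derive_near_eq0 (R : realType) (V : normedModType R) (f : V -> R) a v :
  (\forall y \near a, f y = 0) -> 'D_v f a = 0.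
Proof. by move=> f0; rewrite -(derive_cst (0 : R) a v); exact: near_eq_derive. Qed.

Lemma near_lt_norm (R : realType) (V : normedModType R) (x : V) (K : R) :
  K < `|x| -> \forall y \near x, K < `|y|.
Proof.
have : `|y| @[y --> x] --> `|x| by apply: cvg_norm.
by move=> /cvgr_gt; exact.
Qed.

Lemma integral_derive1_eq0 (R : realType) (f : R -> R) (K : R) :
  (forall x, derivable f x 1) -> continuous (derive1 f) ->
  (forall x, K < `|x| -> f x = 0) ->
  (\int[lebesgue_measure]_x ((derive1 f x)%:E) = 0)%E.
Proof.
(* [K] may be negative; this [L] is positive and exceeds [K], so [f] vanishes at both ends of
   [[-L, L]]. *)
move=> df cf f0; pose L := `|K| + 1.
have KL : K < L by rewrite (le_lt_trans (ler_norm K))// ltrDl.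
have L0 : 0 < L by rewrite ltr_wpDl.
have df0 x : L < `|x| -> derive1 f x = 0.
  move=> /near_lt_norm Lx; rewrite derive1E; apply: derive_near_eq0.
  by apply: filterS Lx => y Ly; rewrite f0// (lt_trans KL).
have -> : (\int[lebesgue_measure]_x (derive1 f x)%:E =
    \int[lebesgue_measure]_(x in `[(- L)%R, L]) (derive1 f x)%:E)%E.
  rewrite [RHS]integral_mkcond; apply: eq_integral => x _.
  rewrite patchE; case: ifPn => //; rewrite notin_setE /= in_itv/= => /negP.
  by rewrite -ler_norml -ltNge => /df0 ->.
rewrite (@continuous_FTC2 R (derive1 f) f).
- have L0' := ltW L0; rewrite (f0 L) ?(ger0_norm L0')//.
  by rewrite (f0 (- L)) ?subee// normrN (ger0_norm L0').
- by rewrite (lt_trans _ L0)// oppr_lt0.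
- exact/continuous_subspaceT.
- split.
  + by move=> x _; exact: df.
  + apply: cvg_at_right_filter; apply: differentiable_continuous.
    exact/derivable1_diffP.
  + apply: cvg_at_left_filter; apply: differentiable_continuous.
    exact/derivable1_diffP.
- by [].
Qed.

Section bounded_support.
Variables (R : realType) (n : nat).
Implicit Types (G F : 'rV[R]_n -> R) (x y : 'rV[R]_n).
Local Notation leb := (lebesgue_rV R n).

Lemma ball_rV_compact (K : R) : compact [set v : 'rV[R]_n | `|v| <= K].
Proof.
apply: bounded_closed_compact.
  by exists K; split; [exact: num_real|move=> M KM v /= /le_trans; apply; exact: ltW].
apply: (@closed_comp _ _ (fun v : 'rV[R]_n => `|v|) [set y | y <= K]) => [v _|].
  exact: norm_continuous.
exact: closed_le.
Qed.

Lemma continuous_compact_bounded G (A : set 'rV[R]_n) : compact A ->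
  {within A, continuous G} -> exists C, forall x, A x -> `|G x| <= C.
Proof.
move=> cA cG; have /compact_bounded[M [_ HM]] := continuous_compact cG cA.
exists (`|M| + 1) => x Ax; apply: HM; last by exists x.
by rewrite ltr_pwDr// ler_norm.
Qed.

Lemma continuous_bounded_support G (K : R) : continuous G ->
  (forall x, K < `|x| -> G x = 0) -> exists C, forall x, `|G x| <= C.
Proof.
move=> cG G0.
have [C HC] := continuous_compact_bounded (@ball_rV_compact K)
  (continuous_subspaceT cG).
exists `|C| => x; have [xK|Kx] := leP `|x| K.
  by rewrite (le_trans (HC _ xK))// ler_norm.
by rewrite G0// normr0.
Qed.

Lemma rintegrable_bounded_set (A : set 'rV[R]_n) G (C : R) :
  measurable A -> bounded_set A -> measurable_fun A G ->
  (forall x, A x -> `|G x| <= C) -> rintegrable leb A G.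
Proof.
move=> mA bA mG GC; apply: measurable_bounded_integrable => //.
  exact: lebesgue_bounded_lty.
by exists C; split; [exact: num_real|move=> M CM x Ax; apply: (le_trans (GC _ Ax)); exact: ltW].
Qed.

Lemma rintegrable_bounded_support G (K : R) : continuous G ->
  (forall x, K < `|x| -> G x = 0) -> rintegrable leb setT G.
Proof.
move=> cG G0; have [C HC] := continuous_bounded_support cG G0.
pose A := [set v : 'rV[R]_n | `|v| <= K].
have mA : measurable A by apply: compact_rV_measurable; exact: ball_rV_compact.
have mG : measurable_fun [set: 'rV[R]_n] G.
  by apply: continuous_measurable_rV => [|x _]; [exact: openT|exact: cG].
have : rintegrable leb A G.
  apply: (@rintegrable_bounded_set _ _ C) => //.
  - exact/compact_bounded/ball_rV_compact.
  - exact: measurable_funTS.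
rewrite /rintegrable integrable_mkcond// => /eq_integrable; apply => //.
move=> x _; rewrite patchE; case: ifPn => //.
by rewrite notin_setE /A /= => /negP; rewrite -ltNge => /G0 ->.
Qed.

End bounded_support.

(** * Slices along the first coordinate *)

Section slices.
Variables (R : realType) (n : nat).
Implicit Types (F : 'rV[R]_n.+1 -> R) (x y : R) (v w : 'rV[R]_n).

Definition row_cons x v : 'rV[R]_n.+1 := rVcons (x, v).

Lemma row_cons0 x v : row_cons x v ord0 ord0 = x.
Proof. by rewrite mxE unlift_none. Qed.

Lemma row_consS x v i : row_cons x v ord0 (lift ord0 i) = v ord0 i.
Proof. by rewrite mxE liftK. Qed.

Lemma row_cons_continuousl v : continuous (row_cons ^~ v).
Proof.
move=> x U /nbhs_rVP[e e0 eU]; apply/nbhs_ballP; exists e => //= y xy.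
apply: eU => i; case: (unliftP ord0 i) => [j|] ->; rewrite ?row_cons0 ?row_consS.
  by rewrite subrr normr0.
by rewrite distrC.
Qed.

Lemma row_cons_continuousr x : continuous (row_cons x).
Proof.
move=> v U /nbhs_rVP[e e0 eU]; apply/nbhs_rVP; exists e => // w vw.
apply: eU => i; case: (unliftP ord0 i) => [j|] ->; rewrite ?row_cons0 ?row_consS//.
by rewrite subrr normr0.
Qed.

Lemma row_cons_normr x v : `|v| <= `|row_cons x v|.
Proof.
apply: norm_rV_le => // i; have := ler_norm_coord (row_cons x v) (lift ord0 i).
by rewrite row_consS.
Qed.

Lemma row_cons_norml x v : `|x| <= `|row_cons x v|.
Proof. by have := ler_norm_coord (row_cons x v) ord0; rewrite row_cons0. Qed.

(** The difference quotients agree as functions of [h], so derivability and the value of the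
    derivative both pass to the slice. *)
Lemma row_cons_shift0 F x v :
  (fun h : R => h^-1 *: ((F \o shift (row_cons x v)) (h *: delta_mx ord0 ord0) -
     F (row_cons x v))) =
  (fun h : R => h^-1 *: (((fun y => F (row_cons y v)) \o shift x) (h *: 1) -
     F (row_cons x v))).
Proof.
apply/funext => h /=; congr (_ *: (F _ - _)); apply/rowP => i.
rewrite !mxE; case: unliftP => [j|] -> /=.
  by rewrite ?mxE mulr0 add0r.
by rewrite /GRing.scale /=.
Qed.

Lemma row_cons_shiftS F x v j :
  (fun h : R => h^-1 *: ((F \o shift (row_cons x v)) (h *: delta_mx ord0 (lift ord0 j)) -
     F (row_cons x v))) =
  (fun h : R => h^-1 *: (((fun w => F (row_cons x w)) \o shift v) (h *: delta_mx ord0 j) -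
     F (row_cons x v))).
Proof.
apply/funext => h /=; congr (_ *: (F _ - _)); apply/rowP => i.
rewrite !mxE; case: unliftP => [k|] -> /=.
  by rewrite !mxE (inj_eq lift_inj).
by rewrite ?mxE mulr0 add0r.
Qed.

End slices.

(** Induction on [n] with Fubini, since Lebesgue measure on R^(n+1) is the image of a product. For
    the first coordinate the inner integral is one-dimensional and vanishes by the fundamental
    theorem of calculus; for any other one the induction hypothesis applies to the slice with first
    coordinate fixed. Regularity is asked in direction [i] only, and slices inherit it. *)
Lemma integral_partial_eq0 (R : realType) (n : nat) (i : 'I_n)
    (F : 'rV[R]_n -> R) (K : R) :
  (forall x, derivable F x (delta_mx ord0 i)) -> continuous (partial i F) ->
  (forall x, K < `|x| -> F x = 0) ->
  (\int[lebesgue_rV R n]_x (partial i F x)%:E = 0)%E.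
Proof.
elim: n i F => [[]//|n IH] i F dF cF F0.
have dF0 x : K < `|x| -> partial i F x = 0.
  move=> /near_lt_norm Kx; apply: derive_near_eq0.
  by apply: filterS Kx => y; exact: F0.
have iF := rintegrable_bounded_support cF dF0.
have mF : measurable_fun [set: 'rV[R]_n.+1] (EFin \o partial i F).
  exact: measurable_int iF.
have iFc : (lebesgue_measure \x lebesgue_rV R n)%E.-integrable setT
    ((EFin \o partial i F) \o @rVcons R n).
  apply/integrableP; split.
    by apply: measurableT_comp => //; exact: measurable_rVcons.
  move/integrableP : iF => [_].
  rewrite (ge0_integral_pushforward (@measurable_rVcons R n))//.
  exact: measurableT_comp.
have -> : (\int[lebesgue_rV R n.+1]_x (partial i F x)%:E =
    \int[lebesgue_measure \x lebesgue_rV R n]_z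
      ((EFin \o partial i F) \o @rVcons R n) z)%E.
  exact: (integral_pushforward (@measurable_rVcons R n) mF iFc measurableT).
case: (unliftP ord0 i) => [j|] ij.
  rewrite -integral12_prod_meas1// integral0_eq// => x _.
  rewrite /fubini_F /=.
  rewrite (_ : (fun v => _) = fun v => (partial j (fun w => F (row_cons x w)) v)%:E).
    apply: (IH j (fun w => F (row_cons x w))) => [v|v|v Kv].
    - have := dF (row_cons x v); rewrite /derivable ij row_cons_shiftS; exact.
    - rewrite (_ : partial j _ = partial i F \o row_cons x).
        by apply: continuous_comp; [exact: row_cons_continuousr|exact: cF].
      by apply/funext => w; rewrite /partial/= /derive ij row_cons_shiftS.
    - by rewrite F0// (lt_le_trans Kv)// row_cons_normr.
  by apply/funext => v; rewrite /partial /derive ij -row_cons_shiftS.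
rewrite -integral21_prod_meas1// integral0_eq// => v _.
rewrite /fubini_G /=.
have E : (fun x => (partial i F (rVcons (x, v)))) = derive1 (fun x => F (row_cons x v)).
  by apply/funext => x; rewrite derive1E /partial /derive ij -row_cons_shift0.
rewrite (_ : (fun x => _) = fun x => (derive1 (fun y => F (row_cons y v)) x)%:E).
  apply: (@integral_derive1_eq0 _ _ K) => [x|x|x Kx].
  - have := dF (row_cons x v); rewrite /derivable ij row_cons_shift0; exact.
  - rewrite -[derive1 _]E; move: x.
    suff : continuous (partial i F \o (fun x => row_cons x v)) by [].
    move=> y; apply: continuous_comp; last exact: cF.
    exact: row_cons_continuousl.
  - by rewrite F0// (lt_le_trans Kx)// row_cons_norml.
by apply/funext => x; rewrite -E.
Qed.

(** * Smooth bump functions *)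

Section flat_functions.
Variable R : realType.
Implicit Types (P Q : {poly R}) (x y t : R).

(** The polynomial factor makes the family [P(1/x) exp(-1/x)] closed under differentiation, so that
    smoothness is a single induction. *)
Definition flat P x : R := if 0 < x then P.[x^-1] * expR (- x^-1) else 0.

Lemma horner_norm_le P t : 1 <= t ->
  `|P.[t]| <= (\sum_(i < size P) `|P`_i|) * t ^+ size P.
Proof.
move=> t1; rewrite horner_coef mulr_suml (le_trans (ler_norm_sum _ _ _))//.
apply: ler_sum => i _; rewrite normrM normrX ler_wpM2l// (ger0_norm (le_trans ler01 t1)).
by rewrite ler_weXn2l// ltnW.
Qed.

(** A quadratic bound is enough for a zero derivative at 0. It comes from [t^(N+2) <= (N+2)! exp t]
    at [t = 1/x], where [N = size P] bounds the growth of [P]. *)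
Lemma flat_le P : exists2 C, 0 <= C & forall x, `|x| <= 1 -> `|flat P x| <= C * x ^+ 2.
Proof.
pose S := \sum_(i < size P) `|P`_i|; have S0 : 0 <= S by exact: sumr_ge0.
exists (S * ((size P).+2)`!%:R) => [|x x1]; first by rewrite mulr_ge0.
rewrite /flat; case: ifPn => x0; last by rewrite normr0 mulr_ge0 ?sqr_ge0// mulr_ge0.
have xi : 1 <= x^-1 by rewrite invf_ge1// (le_trans (ler_norm _)).
have xi0 : 0 < x^-1 by rewrite invr_gt0.
rewrite normrM (ger0_norm (expR_ge0 _)).
apply: (@le_trans _ _ (S * x^-1 ^+ size P * expR (- x^-1))).
  by rewrite ler_wpM2r ?expR_ge0// horner_norm_le.
rewrite -!mulrA ler_wpM2l// expRN ler_pdivrMr ?expR_gt0//.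
have := @expR_ge1Dxn R x^-1 (size P).+1 (ltW xi0).
set E := expR _; set f := _%:R => h.
have f0 : 0 < f by rewrite ltr0n fact_gt0.
have {}h : x^-1 ^+ (size P).+2 <= f * E.
  by rewrite mulrC -ler_pdivrMr// (le_trans _ h)// lerDr.
have -> : x^-1 ^+ size P = x^-1 ^+ (size P).+2 * x ^+ 2.
  by rewrite -addn2 exprD -mulrA -exprMn mulVf ?gt_eqF// expr1n mulr1.
by rewrite [leRHS]mulrAC mulrC [leRHS]mulrC ler_wpM2l// sqr_ge0.
Qed.

Lemma is_derive_flat P x :
  is_derive x 1 (flat P) (flat ('X^2 * (P - P^`())) x).
Proof.
have [x0|x0|x0] := ltgtP x 0.
- rewrite /flat ltNge (ltW x0) /=.
  apply: (@near_eq_is_derive _ _ _ (cst 0)).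
  near=> y; rewrite /flat ifF//; apply/negbTE; rewrite -leNgt ltW//; near: y.
  exact: lt_nbhsl.
- pose q t := P.[t] * expR (- t).
  apply: (@near_eq_is_derive _ _ _ (q \o GRing.inv)).
    by near=> y; rewrite /flat ifT//; near: y; exact: lt_nbhsr.
  have dq : is_derive x^-1 1 q ((P^`() - P).[x^-1] * expR (- x^-1)).
    have dN : is_derive x^-1 1 (expR \o -%R) (expR (- x^-1) * -1).
      by apply: is_derive1_comp; exact: is_derive_expR.
    have dP := is_derive_poly P x^-1.
    apply: (is_derive_eq (is_deriveM dP dN)).
    by rewrite /GRing.scale/= hornerD hornerN; ring.
  have dV : is_derive x 1 (GRing.inv : R -> R) (- x ^- 2 *: 1).
    by apply: is_deriveV; rewrite ?gt_eqF//; exact: is_derive_id.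
  apply: (is_derive_eq (is_derive1_comp dq dV)).
  rewrite /flat x0 !hornerE /GRing.scale /= !hornerE exprVn; ring.
(* At 0 the difference quotient is at most [C |h|] in absolute value, by the quadratic bound. *)
- rewrite x0 {2}/flat ltxx.
  suff h : (fun h : R => h^-1 *: ((flat P \o shift 0) (h *: 1) - flat P 0)) @ 0^' --> (0 : R).
    by apply: DeriveDef; [exact: cvgP h|exact: cvg_lim h].
  have [C C0 HC] := flat_le P.
  have f0 : flat P 0 = 0 by rewrite /flat ltxx.
  apply/cvgr0Pnorm_le => e e0; near=> h.
  rewrite /= f0 subr0 addr0 /GRing.scale/= mulr1 normrM normfV.
  have h0 : h != 0 by near: h; exact: nbhs_dnbhs_neq.
  have h1 : `|h| <= 1 by near: h; exact: dnbhs0_le.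
  have h2 : `|h| <= e / (C + 1).
    by near: h; apply: dnbhs0_le; rewrite divr_gt0// ltr_wpDl.
  have hp : 0 < `|h| by rewrite normr_gt0.
  rewrite mulrC ler_pdivrMr// (le_trans (HC _ h1))//.
  rewrite -[h ^+ 2]real_normK ?num_real// expr2 mulrA ler_wpM2r//.
  move: h2; rewrite ler_pdivlMr ?ltr_wpDl// mulrDr mulr1 => h2.
  by rewrite mulrC (le_trans _ h2)// lerDl.
Unshelve. all: by end_near. Qed.

End flat_functions.

(** * Functions of class C^k and bumps on boxes *)

Section Ck_calculus.
Variables (R : realType) (n : nat).
Implicit Types (f g : 'rV[R]_n -> R) (k : nat) (U : set 'rV[R]_n).

Lemma CkS k U f : Ck k.+1 U f -> Ck k U f.
Proof.
elim: k f => [f [cf _]|k IH f [cf df]]; first by split.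
split=> // i; have [dfi Ci] := df i; split => //; exact: IH.
Qed.

Lemma Ck_cst k (c : R) : Ck k [set: 'rV[R]_n] (cst c).
Proof.
elim: k c => [c|k IH c]; first by split=> // x _; exact: cst_continuous.
split=> [x _|i]; first exact: cst_continuous.
split=> [x _|]; first exact: derivable_cst.
rewrite (_ : partial i (cst c) = cst 0); first exact: IH.
by apply/funext => x; rewrite /partial derive_cst.
Qed.

Lemma CkD k f g : Ck k setT f -> Ck k setT g -> Ck k setT (fun x => f x + g x).
Proof.
elim: k f g => [f g [cf _] [cg _]|k IH f g [cf df] [cg dg]].
  split=> // x _; exact: (cvgD (cf x I) (cg x I)).
split=> [x _|i]; first exact: (cvgD (cf x I) (cg x I)).
have [dfi Cf] := df i; have [dgi Cg] := dg i; split=> [x _|].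
  by apply: derivableD; [exact: dfi|exact: dgi].
rewrite (_ : partial i _ = (fun x => partial i f x + partial i g x)); first exact: IH.
by apply/funext => x; rewrite /partial deriveD//; [exact: dfi|exact: dgi].
Qed.

Lemma CkM k f g : Ck k setT f -> Ck k setT g -> Ck k setT (fun x => f x * g x).
Proof.
elim: k f g => [f g [cf _] [cg _]|k IH f g Cf Cg].
  split=> // x _; exact: (cvgM (cf x I) (cg x I)).
have Cf' := CkS Cf; have Cg' := CkS Cg; move: Cf Cg => [cf df] [cg dg].
split=> [x _|i]; first exact: (cvgM (cf x I) (cg x I)).
have [dfi Cfi] := df i; have [dgi Cgi] := dg i; split=> [x _|].
  by apply: derivableM; [exact: dfi|exact: dgi].
rewrite (_ : partial i _ = (fun x => f x * partial i g x + g x * partial i f x)).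
  by apply: CkD; exact: IH.
by apply/funext => x; rewrite /partial deriveM//; [exact: dfi|exact: dgi].
Qed.

Lemma Ck_prod k (s : seq 'I_n) (f : 'I_n -> 'rV[R]_n -> R) :
  (forall i, Ck k setT (f i)) -> Ck k setT (fun x => \prod_(i <- s) f i x).
Proof.
move=> Cf; elim: s => [|i s IH].
  by rewrite (_ : (fun x => _) = cst 1); [exact: Ck_cst|apply/funext => x; rewrite big_nil].
rewrite (_ : (fun x => _) = (fun x => f i x * \prod_(j <- s) f j x)); first exact: CkM.
by apply/funext => x; rewrite big_cons.
Qed.

Lemma is_derive_coord (g : R -> R) (i j : 'I_n) (v : 'rV[R]_n) (dg : R) :
  is_derive (v ord0 i) 1 g dg ->
  is_derive v (delta_mx ord0 j) (fun w => g (w ord0 i)) (if i == j then dg else 0).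
Proof.
case: eqVneq => [<-|ij] dgv.
  have E : (fun h : R => h^-1 *: (((fun w : 'rV[R]_n => g (w ord0 i)) \o shift v)
        (h *: delta_mx ord0 i) - g (v ord0 i))) =
      (fun h : R => h^-1 *: ((g \o shift (v ord0 i)) (h *: 1) - g (v ord0 i))).
    by apply/funext => h /=; rewrite !mxE !eqxx.
  apply: DeriveDef; first by rewrite /derivable E; exact: ex_derive.
  by rewrite /derive E; exact: derive_val.
have E : (fun h : R => h^-1 *: (((fun w : 'rV[R]_n => g (w ord0 i)) \o shift v)
      (h *: delta_mx ord0 j) - g (v ord0 i))) = (fun h : R => 0).
  by apply/funext => h /=; rewrite !mxE (negbTE ij) andbF mulr0 add0r subrr scaler0.
apply: DeriveDef; first by rewrite /derivable E; exact: is_cvg_cst.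
by rewrite /derive E; exact: lim_cst.
Qed.

Lemma Ck_flat k (P : {poly R}) (c d : R) (i : 'I_n) :
  Ck k setT (fun v : 'rV[R]_n => flat P (c * v ord0 i + d)).
Proof.
have D (Q : {poly R}) (v : 'rV[R]_n) j : is_derive v (delta_mx ord0 j)
    (fun w : 'rV[R]_n => flat Q (c * w ord0 i + d))
    (if i == j then flat ('X^2 * (Q - Q^`())) (c * v ord0 i + d) * c else 0).
  apply: (is_derive_coord (g := fun t => flat Q (c * t + d))).
  apply: (@is_derive1_comp _ _ (fun t => c * t + d)); first exact: is_derive_flat.
  have -> : (fun t => c * t + d) = (c \*: id) + cst d by apply/funext.
  by apply: is_derive_eq; rewrite addr0 /GRing.scale /= mulr1.
have cont (Q : {poly R}) : continuous (fun v : 'rV[R]_n => flat Q (c * v ord0 i + d)).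
  move=> v; apply: (@continuous_comp _ _ _ (fun v : 'rV[R]_n => c * v ord0 i + d) (flat Q)).
    have h : (fun w : 'rV[R]_n => c * w ord0 i) w @[w --> v] --> c * v ord0 i.
      exact: (cvgM (cvg_cst c) (@coord_continuous R 1 n ord0 i v)).
    exact: (cvgD h (cvg_cst d)).
  apply: differentiable_continuous; apply/derivable1_diffP.
  by have [] := is_derive_flat Q (c * v ord0 i + d).
elim: k P => [P|k IH P]; first by split=> // x _; exact: cont.
split=> [x _|j]; first exact: cont.
split=> [x _|]; first by have [] := D P x j.
rewrite (_ : partial j _ = fun v => (if i == j then c else 0) *
    flat ('X^2 * (P - P^`())) (c * v ord0 i + d)).
  by apply: CkM; [exact: Ck_cst|exact: IH].
apply/funext => v; rewrite /partial (@derive_val _ _ _ _ _ _ _ (D P v j)).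
by case: ifP; rewrite ?mul0r// mulrC.
Qed.

(** The factors are [exp(-1/((k+1) t))] for [t = v_i - a_i] and [t = b_i - v_i], cut to 0 when
    [t <= 0]. As [k] grows they tend to 1 for [t > 0], whence the indicator of the open box. The
    affine arguments are expanded to fit [Ck_flat]. *)
Definition box_bump (a b : 'I_n -> R) (k : nat) (v : 'rV[R]_n) : R :=
  \prod_(i < n) (flat 1 (k.+1%:R * v ord0 i + k.+1%:R * - a i) *
                 flat 1 (- k.+1%:R * v ord0 i + k.+1%:R * b i)).

Lemma flat1E (t : R) : flat 1 t = if 0 < t then expR (- t^-1) else 0.
Proof. by rewrite /flat hornerC mul1r. Qed.

Lemma flat1_ge0 (t : R) : 0 <= flat 1 t.
Proof. by rewrite flat1E; case: ifP => // _; exact: expR_ge0. Qed.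

Lemma flat1_le1 (t : R) : flat 1 t <= 1.
Proof.
by rewrite flat1E; case: ifP => // t0; rewrite expR_le1 oppr_le0 invr_ge0 ltW.
Qed.

Lemma box_bump_smooth a b k : smooth setT (box_bump a b k).
Proof.
move=> l; rewrite /box_bump; apply: Ck_prod => i.
by apply: CkM; exact: Ck_flat.
Qed.

Lemma box_bump_le1 a b k v : `|box_bump a b k v| <= 1.
Proof.
rewrite normr_prod; apply: prodr_ile1 => i _; rewrite normr_ge0 /=.
rewrite normrM !(ger0_norm (flat1_ge0 _)).
by rewrite mulr_ile1 ?flat1_ge0 ?flat1_le1.
Qed.

Lemma box_bump_out a b k v : ~ cbox a b v -> box_bump a b k v = 0.
Proof.
move=> /existsNP[i /=]; rewrite in_itv/= => /negP; rewrite negb_and -!ltNge => vi.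
rewrite /box_bump (bigD1 i)//= !flat1E.
have k0 : 0 < k.+1%:R :> R by [].
case/orP: vi => h.
  rewrite -mulrDr pmulr_rgt0// subr_gt0 [X in if X then _ else _]ltNge (ltW h) /=.
  by rewrite !mul0r.
rewrite [X in _ * (if X then _ else _)](_ : _ = false) ?mulr0 ?mul0r//.
by rewrite mulNr -mulrN -mulrDr pmulr_rgt0// addrC subr_gt0 ltNge (ltW h).
Qed.

Lemma flat1_cvg (t : R) : 0 < t -> flat 1 (k.+1%:R * t) @[k --> \oo] --> (1 : R).
Proof.
move=> t0; rewrite (_ : (fun k => _) = (fun k => expR (- (t^-1 * k.+1%:R^-1)))).
  rewrite -[X in _ --> X](@expR0 R); apply: continuous_cvg; first exact: continuous_expR.
  rewrite -oppr0; apply: cvgN; rewrite -(mulr0 t^-1); apply: cvgM; first exact: cvg_cst.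
  exact: cvg_harmonic.
by apply/funext => k; rewrite flat1E mulr_gt0// invfM mulrC.
Qed.

Lemma box_bump_cvg a b v : box_bump a b k v @[k --> \oo] --> (\1_(obox a b) v : R).
Proof.
rewrite indicE; have [/set_mem vab|/negP] := boolP (v \in obox a b).
  pose F i (k : nat) := flat 1 (k.+1%:R * v ord0 i + k.+1%:R * - a i) *
                 flat 1 (- k.+1%:R * v ord0 i + k.+1%:R * b i).
  have F1 i : F i @ \oo --> (1 : R).
    move: (vab i); rewrite /= in_itv/= => /andP[av vb].
    rewrite -[X in _ --> X]mul1r; apply: cvgM.
      under eq_cvg do rewrite -mulrDr.
      by apply: flat1_cvg; rewrite subr_gt0.
    under eq_cvg do rewrite mulNr -mulrN -mulrDr.
    by apply: flat1_cvg; rewrite addrC subr_gt0.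
  suff FP s : (fun k => \prod_(i <- s) F i k) @ \oo --> (1 : R) by exact: FP.
  elim: s => [|i s IH].
    rewrite (_ : (fun k => _) = cst 1); first exact: cvg_cst.
    by apply/funext => k; rewrite big_nil.
  rewrite (_ : (fun k => _) = (fun k => F i k * \prod_(j <- s) F j k)).
    by rewrite -[X in _ --> X]mul1r; exact: (cvgM (F1 i) IH).
  by apply/funext => k; rewrite big_cons.
rewrite inE => vab; apply: cvg_near_cst; apply: nearW => k.
move: vab => /existsNP[i /=]; rewrite in_itv/= => /negP; rewrite negb_and -!leNgt => vi.
rewrite /box_bump (bigD1 i)//= !flat1E.
have k0 : 0 < k.+1%:R :> R by [].
case/orP: vi => h.
  rewrite -mulrDr pmulr_rgt0// subr_gt0 [X in if X then _ else _]ltNge h /=.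
  by rewrite !mul0r.
rewrite [X in _ * (if X then _ else _)](_ : _ = false) ?mulr0 ?mul0r//.
by rewrite mulNr -mulrN -mulrDr pmulr_rgt0// addrC subr_gt0 ltNge h.
Qed.

End Ck_calculus.

(** * Uniqueness of weak derivatives *)

Section directional_C1.
Variables (R : realType) (n : nat).
Implicit Types (F G u v : 'rV[R]_n -> R) (D K : set 'rV[R]_n) (i : 'I_n).
Local Notation leb := (lebesgue_rV R n).

(** This is the regularity that integration by parts in direction [i] consumes. It holds for test
    functions, for coordinates, and for cut-off C^1 functions that are not smooth. *)
Definition C1_dir i F := [/\ continuous F, forall x, derivable F x (delta_mx ord0 i)
  & continuous (partial i F)].

Lemma partialM i F G x : derivable F x (delta_mx ord0 i) ->
  derivable G x (delta_mx ord0 i) ->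
  partial i (fun x => F x * G x) x = F x * partial i G x + G x * partial i F x.
Proof. by move=> dF dG; exact: (deriveM dF dG). Qed.

Lemma C1_dirM i F G : C1_dir i F -> C1_dir i G -> C1_dir i (fun x => F x * G x).
Proof.
move=> [cF dF cdF] [cG dG cdG]; split.
- by move=> x; exact: (cvgM (cF x) (cG x)).
- by move=> x; exact: (derivableM (dF x) (dG x)).
- rewrite (_ : partial i _ = fun x => F x * partial i G x + G x * partial i F x).
    move=> x; exact: (cvgD (cvgM (cF x) (cdG x)) (cvgM (cG x) (cdF x))).
  by apply/funext => x; rewrite partialM.
Qed.

Lemma partial_out i F D : open D -> (forall x, D x -> F x = 0) ->
  forall x, D x -> partial i F x = 0.
Proof.
move=> oD F0 x Dx; apply: derive_near_eq0.
by apply: filterS (open_nbhs_nbhs (conj oD Dx)) => y; exact: F0.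
Qed.

Lemma compact_rV_norm K : compact K -> exists r : R, forall x, K x -> `|x| <= r.
Proof.
by move=> /compact_bounded/bounded_rV_norm[r _ Kr]; exists r => x /Kr.
Qed.

(** The product [F G] inherits the bounded support of [G], so the integral of its partial derivative
    vanishes. *)
Lemma integration_by_parts_rV i F G K : compact K ->
  C1_dir i F -> C1_dir i G -> (forall x, ~ K x -> G x = 0) ->
  \int[leb]_x (F x * partial i G x) = - \int[leb]_x (partial i F x * G x).
Proof.
move=> cK CF CG G0; have [r Kr] := compact_rV_norm cK.
have Gr0 x : r < `|x| -> G x = 0.
  by move=> rx; apply: G0 => /Kr; rewrite leNgt rx.
have dGr0 x : r < `|x| -> partial i G x = 0.
  have oC : open [set y : 'rV[R]_n | r < `|y|].
    apply: (@open_comp _ _ (fun v : 'rV[R]_n => `|v|) [set y | r < y]) => [v _|].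
      exact: norm_continuous.
    exact: open_gt.
  by move=> rx; apply: (partial_out i oC) => // y; exact: Gr0.
have [cF dF cdF] := CF; have [cG dG cdG] := CG.
have [_ dFG cdFG] := C1_dirM CF CG.
have i1 : rintegrable leb setT (fun x => F x * partial i G x).
  apply: (@rintegrable_bounded_support _ _ _ r) => x; last by move=> /dGr0 ->; rewrite mulr0.
  exact: (cvgM (cF x) (cdG x)).
have i2 : rintegrable leb setT (fun x => partial i F x * G x).
  apply: (@rintegrable_bounded_support _ _ _ r) => x; last by move=> /Gr0 ->; rewrite mulr0.
  exact: (cvgM (cdF x) (cG x)).
apply/eqP; rewrite -addr_eq0 -RintegralD//; apply/eqP.
have := @integral_partial_eq0 R n i (fun x => F x * G x) r dFG cdFG.
have FG0 x : r < `|x| -> F x * G x = 0 by move=> /Gr0 ->; rewrite mulr0.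
move=> /(_ FG0) h; rewrite /Rintegral -[RHS]/(fine 0%E) -h.
by congr fine; apply: eq_integral => x _; rewrite partialM// [_ * partial i F x]mulrC.
Qed.

Lemma test_function_C1_dir i D v : test_function D v -> C1_dir i v.
Proof.
move=> [sv _]; have [cv dv] := sv 1%N; have [dvi [cdv _]] := dv i; split.
- by move=> x; exact: cv.
- by move=> x; exact: dvi.
- by move=> x; exact: cdv.
Qed.

Lemma test_functionD D u v : test_function D u -> test_function D v ->
  test_function D (fun x => u x + v x).
Proof.
move=> [su [K [cK KD u0]]] [sv [L [cL LD v0]]]; split.
  by move=> k; exact: CkD.
exists (K `|` L); split; first exact: compactU.
  by rewrite subUset.
by move=> x /not_orP[Kx Lx]; rewrite u0// v0// addr0.
Qed.

Lemma test_functionZ D c u : test_function D u -> test_function D (fun x => c * u x).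
Proof.
move=> [su [K [cK KD u0]]]; split.
  by move=> k; apply: CkM => //; exact: Ck_cst.
by exists K; split => // x /u0 ->; rewrite mulr0.
Qed.

Lemma Rintegral_supp D K F : K `<=` D -> (forall x, ~ K x -> F x = 0) ->
  \int[leb]_(x in D) F x = \int[leb]_x F x.
Proof.
move=> KD F0; rewrite Rintegral_mkcond; apply: eq_Rintegral => x _.
rewrite patchE; case: ifPn => //; rewrite notin_setE => Dx; rewrite F0//.
by move=> /KD.
Qed.

End directional_C1.

(** * Local integrability and the fundamental lemma of the calculus of variations *)

Section locally_integrable.
Variables (R : realType) (n : nat) (D : set 'rV[R]_n).
Hypothesis oD : open D.
Implicit Types (g u v w : 'rV[R]_n -> R) (K : set 'rV[R]_n) (i : 'I_n).
Local Notation leb := (lebesgue_rV R n).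

Let mD : measurable D. Proof. exact: open_rV_measurable. Qed.

Lemma locally_integrable_rintegrable K g : locally_integrable_on D g ->
  K `<=` D -> compact K -> rintegrable leb K g.
Proof.
move=> [mg ig] KD cK; apply/integrableP; split; last exact: ig.
by apply/measurable_EFinP; exact: measurable_funS mg.
Qed.

Lemma rintegrable_mul_supp K g w C : locally_integrable_on D g ->
  K `<=` D -> compact K -> measurable_fun D w -> (forall x, `|w x| <= C) ->
  (forall x, ~ K x -> w x = 0) -> rintegrable leb D (fun x => g x * w x).
Proof.
move=> lg KD cK mw wC w0; have [mg _] := lg.
have mK : measurable K by exact: compact_rV_measurable.
have iK : rintegrable leb K (fun x => g x * w x).
  apply: (@rintegrable_eq _ _ _ _ _ mK (fun x => w x * g x)).
    by move=> x _; rewrite mulrC.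
  apply: (@rintegrable_bounded _ _ _ _ _ mK w g C) => //.
    exact: measurable_funS mw.
  exact: locally_integrable_rintegrable.
move: iK; rewrite /rintegrable [X in X -> _]integrable_mkcond// => iK.
rewrite integrable_mkcond//; apply: eq_integrable iK => // x _.
rewrite !patchE; case: ifPn => [xK|]; case: ifPn => //.
- by rewrite notin_setE => nDx; exfalso; apply/nDx/KD; exact: set_mem.
- by rewrite notin_setE => _ nKx; rewrite /= w0 ?mulr0//; exact/notin_setE.
Qed.

Lemma test_function_bounds v i : test_function D v ->
  exists K C, [/\ compact K, K `<=` D, forall x, ~ K x -> v x = 0,
    forall x, ~ K x -> partial i v x = 0 &
    forall x, `|v x| <= C /\ `|partial i v x| <= C].
Proof.
move=> tv; have [cv dv cdv] := test_function_C1_dir i tv.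
have [_ [K [cK KD v0]]] := tv.
have oK : open (~` K) by apply: closed_openC; apply: compact_closed cK; exact: norm_hausdorff.
have dv0 := partial_out i oK v0.
have [r Kr] := compact_rV_norm cK.
have nK x : r < `|x| -> ~ K x by move=> rx /Kr; rewrite leNgt rx.
have [C1 H1] := continuous_bounded_support cv (fun x rx => v0 x (nK x rx)).
have [C2 H2] := continuous_bounded_support cdv (fun x rx => dv0 x (nK x rx)).
exists K, (Num.max C1 C2); split => // x; rewrite !le_max H1 H2 orbT.
by [].
Qed.

Lemma measurable_continuous_rV g : continuous g -> measurable_fun D g.
Proof. by move=> cg; apply: continuous_measurable_rV => // x _; exact: cg. Qed.

Lemma rintegrable_mul_test g v : locally_integrable_on D g -> test_function D v ->
  rintegrable leb D (fun x => g x * v x).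
Proof.
move=> lg tv; have [sv [K0 [cK0 K0D v0]]] := tv; have [cv _] := sv 0%N.
have cv' : continuous v by move=> x; exact: cv.
have [r Kr] := compact_rV_norm cK0.
have vr x : r < `|x| -> v x = 0.
  by move=> rx; apply: v0 => /Kr; rewrite leNgt rx.
have [C HC] := continuous_bounded_support cv' vr.
by apply: (rintegrable_mul_supp lg K0D cK0 _ HC v0); exact: measurable_continuous_rV.
Qed.

Lemma cbox_compact (a b : 'I_n -> R) : compact (cbox a b).
Proof. by apply: rV_compact => i; exact: segment_compact. Qed.

(** Countably many boxes cover [D], so it suffices to work in one whose closure [Q] is compact in
    [D]; there [g] is integrable. The bumps on a smaller box are test functions bounded by 1, so
    dominated convergence with bound [|g|] shows that [g] has integral zero over that box. *)
Lemma ae_eq0_of_test_integrals g : locally_integrable_on D g ->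
  (forall v, test_function D v -> \int[leb]_(x in D) (g x * v x) = 0) ->
  g = cst 0 %[ae leb in D].
Proof.
move=> lg g0; have [P [a [b [abD DE]]]] := open_rV_bigcup_obox oD.
suff H k : P k -> g = cst 0 %[ae leb in obox (a k) (b k)].
  have : \forall x \ae leb, forall k, P k -> obox (a k) (b k) x -> g x = 0.
    apply: ae_foralln => k; have [Pk|nPk] := pselect (P k).
      by apply: filterS (H k Pk) => x + _.
    by apply: filterE => x /nPk.
  by apply: filterS => x Hx; rewrite {1}DE => -[k Pk xk]; exact: Hx Pk xk.
move=> Pk; set Q := cbox (a k) (b k).
have cQ : compact Q by exact: cbox_compact.
have mQ : measurable Q by exact: measurable_cbox.
have iQ : rintegrable leb Q g by apply: locally_integrable_rintegrable => //; exact: abD.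
apply: ae_eq0_of_obox_integrals.
  apply: integrableS iQ => //; first exact: measurable_obox.
  by move=> x xk i; apply: subset_itv_oo_cc; exact: xk.
move=> c e ac eb.
have ceQ : cbox c e `<=` Q.
  move=> x xc i; have /= := xc i; rewrite !in_itv/= => /andP[h1 h2].
  by rewrite (le_trans (ac i) h1) (le_trans h2 (eb i)).
have oceQ : obox c e `<=` Q.
  by move=> x xc; apply: ceQ => i; apply: subset_itv_oo_cc; exact: xc.
have tB j : test_function D (box_bump c e j).
  split; first exact: box_bump_smooth.
  exists (cbox c e); split; first exact: cbox_compact.
  - by apply: subset_trans ceQ _; exact: abD.
  - by move=> x; exact: box_bump_out.
have cB j : continuous (box_bump c e j).
  by have [cB _] := @box_bump_smooth R n c e j 0%N; move=> x; exact: cB.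
have mg : measurable_fun Q g by exact: rintegrable_measurable iQ.
have mB j : measurable_fun Q (box_bump c e j).
  by apply: (@measurable_funS _ _ _ _ D) => //; [exact: abD|exact: measurable_continuous_rV].
have IB j : (\int[leb]_(x in Q) (g x * box_bump c e j x)%:E = 0)%E.
  have B0 x : ~ Q x -> g x * box_bump c e j x = 0.
    by move=> nQ; rewrite box_bump_out ?mulr0// => /ceQ.
  have := g0 _ (tB j); rewrite (Rintegral_supp (abD k Pk) B0).
  rewrite -(Rintegral_supp (subset_refl (A := Q)) B0) => h.
  (* The real integral is the [fine] of the extended one, and [fine] also sends infinities to 0;
     integrability excludes these. *)
  rewrite -[LHS]fineK; first by congr EFin.
  apply: integrable_fin_num => //.
  apply: (@rintegrable_eq _ _ _ _ _ mQ (fun x => box_bump c e j x * g x)).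
    by move=> x _; rewrite mulrC.
  by apply: (@rintegrable_bounded _ _ _ _ _ mQ _ g 1) => // x _; exact: box_bump_le1.
have := @dominated_convergence _ _ _ leb Q mQ
  (fun j x => (g x * box_bump c e j x)%:E) (fun x => (g x * \1_(obox c e) x)%:E)
  (fun x => `|g x|%:E).
case.
- by move=> j; apply/measurable_EFinP; exact: measurable_funM.
- apply/measurable_EFinP; apply: measurable_funM => //.
  by apply: measurable_indic; exact: measurable_obox.
- apply: aeW => x Qx; apply: cvg_EFin; first exact: nearW.
  exact: (cvgM (cvg_cst (g x)) (@box_bump_cvg R n c e x)).
- exact: integrable_norm.
- apply: aeW => x Qx j /=; rewrite lee_fin normrM ler_piMr//.
  exact: box_bump_le1.
move=> _ _; rewrite [X in X @ _](_ : _ = cst 0%E); last by apply/funext => j; exact: IB.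
move=> /cvg_lim; rewrite lim_cst// => /(_ (@ereal_hausdorff R)) h.
transitivity (\int[leb]_(x in Q) (g x * \1_(obox c e) x)%:E)%E; last by rewrite -h.
rewrite [LHS]integral_mkcond [RHS]integral_mkcond; apply: eq_integral => x _.
rewrite !patchE indicE; have [xo|xo] := boolP (x \in obox c e).
  by rewrite (mem_set (oceQ _ (set_mem xo))) mulr1.
by rewrite mulr0; case: ifP.
Qed.

Lemma locally_integrableB g u : locally_integrable_on D g ->
  locally_integrable_on D u -> locally_integrable_on D (fun x => g x - u x).
Proof.
move=> lg lu; split; first by apply: measurable_funB; [case: lg|case: lu].
move=> K KD cK; have mK := compact_rV_measurable cK.
have ig := locally_integrable_rintegrable lg KD cK.
have iu := locally_integrable_rintegrable lu KD cK.
by have /integrableP[] := integrableB mK ig iu.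
Qed.

Lemma weak_partial_unique i u g w : is_weak_partial D i u g ->
  is_weak_partial D i u w -> g = w %[ae leb in D].
Proof.
move=> [_ lg Hg] [_ lw Hw].
have : (fun x => g x - w x) = cst 0 %[ae leb in D].
  apply: ae_eq0_of_test_integrals; first exact: locally_integrableB.
  move=> v tv; rewrite (_ : \int[leb]_(x in D) _ =
      \int[leb]_(x in D) (g x * v x - w x * v x)).
    rewrite RintegralB//; try exact: rintegrable_mul_test.
    by apply/eqP; rewrite subr_eq0 -eqr_opp -Hg// -Hw.
  by apply: eq_Rintegral => x _; rewrite mulrBl.
by apply: filterS => x h /h /eqP; rewrite subr_eq0 => /eqP.
Qed.

Lemma weak_partialP i u g : is_weak_partial D i u g ->
  is_weak_partial D i u (weak_partial D i u).
Proof. by move=> h; apply: (@xgetPex _ (cst 0) [set g | is_weak_partial D i u g]); exists g. Qed.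

Lemma weak_partial_ae i u g : is_weak_partial D i u g ->
  weak_partial D i u = g %[ae leb in D].
Proof. by move=> h; exact: weak_partial_unique (weak_partialP h) h. Qed.

Lemma L2P u : L2 D u <-> sqint leb D u.
Proof.
split=> [uL|[mu iu]].
  have := Lfun2_integrable_sqr uL; move: uL; rewrite /L2 inE => /andP[+ _].
  rewrite inE /= => mu iu; split; first exact/(measurable_restrictT _ mD).
  rewrite /rintegrable integrable_mkcond//; apply: eq_integrable iu => // x _.
  by rewrite /= !patchE; case: ifP => //; rewrite expr0n.
rewrite /L2 inE; apply/andP; split; rewrite inE /=.
  exact/(measurable_restrictT _ mD).
rewrite /finite_norm unlock poweR_lty//.
move: iu; rewrite /rintegrable integrable_mkcond// => /integrableP[_].
congr (_ < _)%E; apply: eq_integral => x _ /=.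
rewrite !patchE; case: ifP => _; last by rewrite abse0 normr0 powR0// pnatr_eq0.
by rewrite /= powR_mulrn// normrX.
Qed.

(** On a compact set, which has finite measure, [|u| <= 1 + u^2]. *)
Lemma sqint_locally_integrable u : sqint leb D u -> locally_integrable_on D u.
Proof.
move=> [mu iu]; split => // K KD cK.
have mK := compact_rV_measurable cK.
have muK : measurable_fun K u by exact: measurable_funS mu.
have : rintegrable leb K u.
  apply: (@rintegrable_le _ _ _ _ _ mK u (fun x => 1 + u x ^+ 2)) => //.
    move=> x _; have := sqr_ge0 (`|u x| - 1); rewrite -[u x ^+ 2]real_normK ?num_real//.
    by have := normr_ge0 (u x); nra.
  apply: rintegrableD => //; last exact: integrableS iu.
  apply: (@rintegrable_bounded_set _ _ _ _ 1) => //; first exact: compact_bounded.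
  by move=> x _; rewrite normr1.
by move=> /integrableP[].
Qed.

End locally_integrable.

(** * A variational form of the Lax-Milgram theorem *)

Section symmetric_Lax_Milgram.
Variables (R : realType) (V : Type) (lc : R -> V -> V -> V) (S : set V).
Variables (a : V -> V -> R) (L : V -> R).
Hypothesis S_lc : forall c u v, S u -> S v -> S (lc c u v).
Hypothesis S_neq0 : S !=set0.
Hypothesis aC : forall u v, S u -> S v -> a u v = a v u.
Hypothesis a_lc : forall c u v w, S u -> S v -> S w ->
  a (lc c u v) w = c * a u w + a v w.
Hypothesis a_ge0 : forall u, S u -> 0 <= a u u.
Hypothesis L_lc : forall c u v, S u -> S v -> L (lc c u v) = c * L u + L v.
Variable C : R.
Hypothesis C_ge0 : 0 <= C.
Hypothesis L_bound : forall u, S u -> L u ^+ 2 <= C * a u u.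
Hypothesis a_complete : forall u : nat -> V, (forall k, S (u k)) ->
  (forall e, 0 < e -> exists K, forall k l, (K <= k)%N -> (K <= l)%N ->
    a (lc (-1) (u l) (u k)) (lc (-1) (u l) (u k)) <= e) ->
  exists2 w, S w & forall e, 0 < e -> exists K, forall k, (K <= k)%N ->
    a (lc (-1) w (u k)) (lc (-1) w (u k)) <= e.

(** The first variation of [J] at [u] in direction [v] is [2 (a u v - L v)], so minimizers solve the
    equation. *)
Let J u := a u u - 2 * L u.

Let a_lc2 c u v : S u -> S v ->
  a (lc c u v) (lc c u v) = c ^+ 2 * a u u + 2 * c * a u v + a v v.
Proof.
move=> Su Sv; have Sl := S_lc c Su Sv.
rewrite a_lc// ![a _ (lc c u v)]aC// !a_lc// [a v u]aC//; ring.
Qed.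

Let J_lc c u v : S u -> S v ->
  J (lc c u v) = J v + 2 * c * (a u v - L u) + c ^+ 2 * a u u.
Proof. by move=> Su Sv; rewrite /J a_lc2// L_lc//; ring. Qed.

(** From [(2 L u)^2 <= 4 C a(u, u) <= (a(u, u) + C)^2]. *)
Let J_lbound u : S u -> - C <= J u.
Proof.
move=> Su; have a0 := a_ge0 Su; have L2 := L_bound Su; rewrite /J.
have [Ca|Ca] := lerP (2 * L u) (a u u + C); first lra.
exfalso; have := sqr_ge0 (a u u - C).
have C0 : 0 <= a u u + C by rewrite addr_ge0.
nra.
Qed.

Let I := inf [set J u | u in S].

Let has_inf_J : has_inf [set J u | u in S].
Proof.
split; first by case: S_neq0 => u Su; exists (J u), u.
by exists (- C) => _ [u Su <-]; exact: J_lbound.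
Qed.

Let I_le u : S u -> I <= J u.
Proof. by move=> Su; apply: ge_inf; [case: has_inf_J|exists u]. Qed.

(* Minimizing sequences are Cauchy by the parallelogram law, and the first
   variation of [J] along such a sequence tends to 0. *)
Lemma symmetric_Lax_Milgram : exists2 u, S u & forall v, S v -> a u v = L v.
Proof.
have /choice[u Hu] : forall k : nat, exists u, S u /\ J u < I + k.+1%:R^-1.
  move=> k; have k0 : 0 < k.+1%:R^-1 :> R by rewrite invr_gt0.
  by have [_ [u Su <-] uI] := inf_adherent k0 has_inf_J; exists u.
have Su k : S (u k) by have [] := Hu k.
have small e : 0 < e -> exists K : nat, forall k, (K <= k)%N -> J (u k) - I <= e.
  move=> e0; exists (Num.trunc e^-1) => k Kk; have [_ /ltW uk] := Hu k.
  rewrite lerBlDl (le_trans uk)// lerD2l -[leRHS]invrK.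
  rewrite lef_pV2 ?posrE ?invr_gt0// (le_trans (ltW (truncnS_gt _)))//.
  by rewrite ler_nat ltnS.
have cauchy e : 0 < e -> exists K, forall k l, (K <= k)%N -> (K <= l)%N ->
    a (lc (-1) (u l) (u k)) (lc (-1) (u l) (u k)) <= e.
  move=> e0; have e4 : 0 < e / 4 by rewrite divr_gt0.
  have [K HK] := small _ e4; exists K => k l Kk Kl.
  have Sd : S (lc (-1) (u l) (u k)) by exact: S_lc.
  (* This is the midpoint of [u k] and [u l]. Since [J] is at least [I] there, [a(u_k - u_l, u_k -
     u_l) <= 2 ((J u_k - I) + (J u_l - I))], which explains [e / 4]. *)
  have Sm : S (lc (- 2^-1) (lc (-1) (u l) (u k)) (u k)) by exact: S_lc.
  have := I_le Sm; have := HK k Kk; have := HK l Kl; rewrite J_lc//.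
  rewrite a_lc2// [a (lc _ _ _) (u k)]a_lc// L_lc// /J.
  move: (a (u l) (u l)) (a (u k) (u k)) (a (u l) (u k)) (L (u k)) (L (u l)).
  move=> all akk alk Lk Ll h1 h2 h3; nra.
have [w Sw Hw] := a_complete Su cauchy.
exists w => // v Sv; apply/eqP; rewrite -subr_eq0 -sqrf_eq0 eq_le sqr_ge0 andbT.
(* [h1] is the discriminant of [t] -> [J (u_k + t v) - I], and [h2] is Cauchy-Schwarz for [a]. The
   two errors are combined by [(x + y)^2 <= 2 x^2 + 2 y^2]. *)
have key k : (a w v - L v) ^+ 2 <=
    2 * (J (u k) - I + a (lc (-1) w (u k)) (lc (-1) w (u k))) * a v v.
  have avv := a_ge0 Sv; have Sd : S (lc (-1) w (u k)) by exact: S_lc.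
  have h1 : (a (u k) v - L v) ^+ 2 <= (J (u k) - I) * a v v.
    apply: discriminant_le => //; first by rewrite subr_ge0 I_le.
    move=> t; have := I_le (S_lc t Sv (Su k)); rewrite J_lc// [a v (u k)]aC//.
    lra.
  have h2 : (a (lc (-1) w (u k)) v) ^+ 2 <= a (lc (-1) w (u k)) (lc (-1) w (u k)) * a v v.
    apply: discriminant_le => //; first exact: a_ge0.
    move=> t; have := a_ge0 (S_lc t Sv Sd); rewrite a_lc2//.
    by rewrite [a v (lc _ _ _)]aC//; lra.
  have h3 : a (lc (-1) w (u k)) v = a (u k) v - a w v by rewrite a_lc//; lra.
  rewrite h3 in h2; have := sqr_ge0 ((a (u k) v - L v) + (a (u k) v - a w v)).
  move: (a (lc _ _ _) _) h1 h2 => d h1 h2; nra.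
apply/ler_addgt0Pl => e e0; rewrite addr0.
(* If both terms in [key] are at most [d], the bound is [4 d a(v, v)]; adding 1 keeps the
   denominator positive. *)
have avv1 : 0 < 4 * (a v v + 1) by rewrite mulr_gt0// ltr_wpDl// a_ge0.
have d0 : 0 < e / (4 * (a v v + 1)) by rewrite divr_gt0.
have [K1 H1] := small _ d0; have [K2 H2] := Hw _ d0.
have := H1 _ (leq_maxl K1 K2); have := H2 _ (leq_maxr K1 K2).
have := key (maxn K1 K2); move: (a (lc _ _ _) _) (J _ - I) => x y.
have : e / (4 * (a v v + 1)) * (4 * (a v v + 1)) = e by rewrite divfK// gt_eqF.
move: d0; move: (e / _) => d d0; have := a_ge0 Sv; move: (a v v) => b b0 <- h hx hy.
rewrite (le_trans h)//; nra.
Qed.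

End symmetric_Lax_Milgram.

(** * The space H^1_0 *)

Section Sobolev_space.
Variables (R : realType) (n : nat) (D : set 'rV[R]_n).
Hypotheses (oD : open D) (bD : bounded_set D).
Implicit Types (f g h u v w p q : 'rV[R]_n -> R) (i j : 'I_n) (c e : R).
Local Notation leb := (lebesgue_rV R n).
Local Notation ip := (ip leb D).
Local Notation sq := (sqint leb D).
Local Notation wp := (weak_partial D).

Let mD : measurable D. Proof. exact: open_rV_measurable. Qed.

(** It plays the role of [lc] in [symmetric_Lax_Milgram]; the difference [u - v] is
    [lincomb (-1) v u]. *)
Definition lincomb c u v : 'rV[R]_n -> R := fun x => c * u x + v x.

Lemma sqint_lc c u v : sq u -> sq v -> sq (lincomb c u v).
Proof. by move=> su sv; apply: (sqintD mD) => //; exact: (sqintZ mD). Qed.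

Lemma ip_lcl c u v w : sq u -> sq v -> sq w ->
  ip (lincomb c u v) w = c * ip u w + ip v w.
Proof.
by move=> su sv sw; rewrite (ipDl mD) ?(ipZl mD)//; exact: (sqintZ mD).
Qed.

Lemma ip_lc_le c u v : sq u -> sq v ->
  ip (lincomb c u v) (lincomb c u v) <= 2 * (c ^+ 2 * ip u u + ip v v).
Proof.
move=> su sv; have scu := sqintZ mD c su; rewrite (le_trans (ipD2_le mD scu sv))//.
by rewrite (ipZl mD)// [ip u (fun x => _)]ipC (ipZl mD)// mulrA expr2.
Qed.

Lemma is_weak_partial_lc i c u v g h : is_weak_partial D i u g ->
  is_weak_partial D i v h ->
  is_weak_partial D i (lincomb c u v) (lincomb c g h).
Proof.
have lc_loc u' v' : locally_integrable_on D u' -> locally_integrable_on D v' ->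
    locally_integrable_on D (lincomb c u' v').
  move=> lu lv; split.
    by apply: measurable_funD; [apply: measurable_funM => //; case: lu|case: lv].
  move=> K KD cK; have mK := compact_rV_measurable cK.
  have iu := locally_integrable_rintegrable oD lu KD cK.
  have iv := locally_integrable_rintegrable oD lv KD cK.
  by have /integrableP[] := rintegrableD mK (rintegrableZ mK c iu) iv.
move=> [lu lg Hg] [lv lh Hh]; split; try exact: lc_loc.
move=> w tw; have [K [C [cK KD w0 dw0 HC]]] := test_function_bounds i tw.
have [cw dw cdw] := test_function_C1_dir i tw.
have mdw : measurable_fun D (partial i w) by exact: measurable_continuous_rV.
have dwC x : `|partial i w x| <= C by have [] := HC x.
have iu := rintegrable_mul_supp oD lu KD cK mdw dwC dw0.
have iv := rintegrable_mul_supp oD lv KD cK mdw dwC dw0.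
have ig := rintegrable_mul_test oD lg tw.
have ih := rintegrable_mul_test oD lh tw.
transitivity (\int[leb]_(x in D) (c * (u x * partial i w x) + v x * partial i w x)).
  by apply: eq_Rintegral => x _; rewrite /lincomb mulrDl mulrA.
rewrite RintegralD//; last exact: rintegrableZ.
rewrite RintegralZl// Hg// Hh//.
transitivity (- \int[leb]_(x in D) (c * (g x * w x) + h x * w x)).
  by rewrite RintegralD//; [rewrite RintegralZl//; ring|exact: rintegrableZ].
by congr (- _); apply: eq_Rintegral => x _; rewrite /lincomb mulrDl mulrA.
Qed.

Lemma H1_sqint u : H1 D u -> sq u.
Proof. by move=> [/(L2P oD)]. Qed.

Lemma H1_weak_partial i u : H1 D u -> is_weak_partial D i u (wp i u).
Proof. by move=> [_ /(_ i)[g ug _]]; exact: weak_partialP ug. Qed.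

Lemma H1_weak_partial_sqint i u : H1 D u -> sq (wp i u).
Proof.
move=> Hu; have [_ /(_ i)[g ug /L2P sg]] := Hu.
have [_ [mwp _] _] := H1_weak_partial i Hu.
apply: (ae_eq_sqint mD mwp) (sg oD).
exact: weak_partial_unique ug (H1_weak_partial i Hu).
Qed.

Lemma H1_intro u (g : 'I_n -> 'rV[R]_n -> R) : sq u ->
  (forall i, is_weak_partial D i u (g i)) -> (forall i, sq (g i)) -> H1 D u.
Proof.
move=> su ug sg; split; first exact/L2P.
by move=> i; exists (g i) => //; exact/L2P.
Qed.

Lemma H1_lc c u v : H1 D u -> H1 D v -> H1 D (lincomb c u v).
Proof.
move=> Hu Hv; apply: (@H1_intro _ (fun i => lincomb c (wp i u) (wp i v))).
- by apply: sqint_lc; exact: H1_sqint.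
- by move=> i; apply: is_weak_partial_lc; exact: H1_weak_partial.
- by move=> i; apply: sqint_lc; exact: H1_weak_partial_sqint.
Qed.

(** The two sides are separate choices of a weak derivative, so equality can be expected only almost
    everywhere. *)
Lemma weak_partial_lc i c u v : H1 D u -> H1 D v ->
  wp i (lincomb c u v) = lincomb c (wp i u) (wp i v) %[ae leb in D].
Proof.
move=> Hu Hv; apply: weak_partial_ae => //.
by apply: is_weak_partial_lc; exact: H1_weak_partial.
Qed.

Lemma ip_weak_partial_lc i c u v w : H1 D u -> H1 D v -> sq w ->
  ip (wp i (lincomb c u v)) w = c * ip (wp i u) w + ip (wp i v) w.
Proof.
move=> Hu Hv sw; have su := H1_weak_partial_sqint i Hu.
have sv := H1_weak_partial_sqint i Hv.
rewrite -ip_lcl//; apply: (ae_eq_ip mD) => //.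
- by apply: H1_weak_partial_sqint; exact: H1_lc.
- exact: sqint_lc.
- exact: weak_partial_lc.
- exact: aeW.
Qed.

Definition H1_sqnorm u : R := ip u u + \sum_(i < n) ip (wp i u) (wp i u).

Lemma H1_sqnorm_ge0 u : 0 <= H1_sqnorm u.
Proof. by rewrite addr_ge0 ?sumr_ge0// => *; exact: ip_ge0. Qed.

Lemma ip_le_H1_sqnorm u : ip u u <= H1_sqnorm u.
Proof. by rewrite lerDl sumr_ge0// => *; exact: ip_ge0. Qed.

Lemma ip_weak_partial_le_H1_sqnorm i u : ip (wp i u) (wp i u) <= H1_sqnorm u.
Proof.
rewrite /H1_sqnorm (bigD1 i)//= addrCA lerDl addr_ge0 ?ip_ge0//.
by rewrite sumr_ge0// => *; exact: ip_ge0.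
Qed.

Lemma H1_sqnorm_lc c u v : H1 D u -> H1 D v ->
  H1_sqnorm (lincomb c u v) <= 2 * (c ^+ 2 * H1_sqnorm u + H1_sqnorm v).
Proof.
move=> Hu Hv; rewrite /H1_sqnorm.
have -> : 2 * (c ^+ 2 * (ip u u + \sum_(i < n) ip (wp i u) (wp i u)) +
    (ip v v + \sum_(i < n) ip (wp i v) (wp i v))) =
    2 * (c ^+ 2 * ip u u + ip v v) +
    \sum_(i < n) 2 * (c ^+ 2 * ip (wp i u) (wp i u) + ip (wp i v) (wp i v)).
  have alg (k A B X Y : R) :
    2 * (k * (A + X) + (B + Y)) = 2 * (k * A + B) + 2 * (k * X + Y) by ring.
  by rewrite -mulr_sumr big_split/= -mulr_sumr; exact: alg.
apply: lerD; first by apply: ip_lc_le; exact: H1_sqint.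
apply: ler_sum => i _; have su := H1_weak_partial_sqint i Hu.
have sv := H1_weak_partial_sqint i Hv; have Hl := H1_lc c Hu Hv.
have sl := H1_weak_partial_sqint i Hl; have scl := sqint_lc c su sv.
rewrite (le_trans _ (ip_lc_le c su sv))//.
by rewrite (ae_eq_ip mD sl scl sl scl (weak_partial_lc i c Hu Hv)
  (weak_partial_lc i c Hu Hv)).
Qed.

Lemma lincombB u v : lincomb (-1) v u = u \- v.
Proof. by apply/funext => x; rewrite /lincomb mulN1r addrC. Qed.

Lemma H10P u : H10 D u <-> H1 D u /\
  forall e, 0 < e -> exists2 v, test_function D v & H1_sqnorm (lincomb (-1) v u) <= e.
Proof.
split=> -[Hu Hd]; split=> // e e0.
  have se : 0 < Num.sqrt e by rewrite sqrtr_gt0.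
  have [v tv uv] := Hd _ se; exists v => //.
  by rewrite lincombB -(ler_sqrt _ (ltW e0)) ltW.
(* Halving [e] turns the large inequality for squares into a strict one for norms. *)
have e2 : 0 < (e / 2) ^+ 2 by rewrite exprn_gt0// divr_gt0.
have [v tv uv] := Hd _ e2; exists v => //; rewrite /H1_norm -lincombB.
rewrite -/(H1_sqnorm _) (@le_lt_trans _ _ (e / 2))//; last by rewrite ltr_pdivrMr// ltr_pMr// ltr1n.
by rewrite (le_trans (ler_wsqrtr uv))// sqrtr_sqr ger0_norm// divr_ge0// ltW.
Qed.

Lemma continuous_sqint g : continuous g -> sq g.
Proof.
move=> cg; have [r _ Dr] := bounded_rV_norm bD.
have [C HC] := continuous_compact_bounded (@ball_rV_compact R n r) (continuous_subspaceT cg).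
have mg := measurable_continuous_rV oD cg; split => //.
apply: (@rintegrable_bounded_set _ _ _ _ (C ^+ 2)) => //; first exact: measurable_funX.
by move=> x /Dr xr; rewrite normrX lerXn2r ?nnegrE// ?(le_trans _ (HC _ xr))// HC.
Qed.

Lemma continuous_bounded_on g : continuous g -> exists C, forall x, D x -> `|g x| <= C.
Proof.
move=> cg; have [r _ Dr] := bounded_rV_norm bD.
have [C HC] := continuous_compact_bounded (@ball_rV_compact R n r) (continuous_subspaceT cg).
by exists C => x /Dr /HC.
Qed.

Lemma sqintM_continuous g u : continuous g -> sq u -> sq (fun x => g x * u x).
Proof.
move=> cg su; have [C HC] := continuous_bounded_on cg.
by apply: (sqintM_bounded mD _ HC) => //; exact: measurable_continuous_rV.
Qed.

Lemma test_by_parts i v h : test_function D v -> C1_dir i h ->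
  ip v (partial i h) = - ip (partial i v) h.
Proof.
move=> tv Ch; have [K [C [cK KD v0 dv0 _]]] := test_function_bounds i tv.
have := integration_by_parts_rV cK Ch (test_function_C1_dir i tv) v0.
rewrite -(@Rintegral_supp _ _ D K); last 2 first.
- exact: KD.
- by move=> x /dv0 ->; rewrite mulr0.
rewrite -(@Rintegral_supp _ _ D K); last 2 first.
- exact: KD.
- by move=> x /v0 ->; rewrite mulr0.
move=> E; rewrite [RHS](_ : _ = - \int[leb]_(x in D) (h x * partial i v x)).
  by rewrite E opprK; apply: eq_Rintegral => x _; rewrite mulrC.
by congr (- _); apply: eq_Rintegral => x _; rewrite mulrC.
Qed.

Lemma test_function_sqint v : test_function D v -> sq v.
Proof. by move=> [sv _]; apply: continuous_sqint => x; have [cv _] := sv 0%N; exact: cv. Qed.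

Lemma test_function_partial_sqint i v : test_function D v -> sq (partial i v).
Proof. by move=> tv; apply: continuous_sqint; have [] := test_function_C1_dir i tv. Qed.

Lemma test_function_weak_partial i v : test_function D v ->
  is_weak_partial D i v (partial i v).
Proof.
move=> tv; split.
- by apply: sqint_locally_integrable => //; exact: test_function_sqint.
- by apply: sqint_locally_integrable => //; exact: test_function_partial_sqint.
- by move=> w tw; apply: (test_by_parts tv); exact: test_function_C1_dir tw.
Qed.

Lemma test_function_H1 v : test_function D v -> H1 D v.
Proof.
move=> tv; apply: (@H1_intro _ (fun i => partial i v)).
- exact: test_function_sqint.
- by move=> i; exact: test_function_weak_partial.
- by move=> i; exact: test_function_partial_sqint.
Qed.

Lemma H10_lc c u v : H10 D u -> H10 D v -> H10 D (lincomb c u v).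
Proof.
move=> /H10P[Hu du] /H10P[Hv dv]; apply/H10P; split=> [|e e0]; first exact: H1_lc.
(* [H1_sqnorm_lc] turns errors at most [d] into [2 (c^2 + 1) d]. *)
have c1 : 0 < 4 * (c ^+ 2 + 1) by rewrite mulr_gt0// ltr_wpDl// sqr_ge0.
have e1 : 0 < e / (4 * (c ^+ 2 + 1)) by rewrite divr_gt0.
have [u' tu' uu'] := du _ e1; have [v' tv' vv'] := dv _ e1.
have tu1 := test_function_H1 tu'; have tv1 := test_function_H1 tv'.
exists (fun x => c * u' x + v' x).
  by apply: test_functionD => //; exact: test_functionZ.
rewrite (_ : lincomb _ _ _ = lincomb c (lincomb (-1) u' u) (lincomb (-1) v' v)); last first.
  by apply/funext => x; rewrite /lincomb; ring.
rewrite (le_trans (H1_sqnorm_lc c (H1_lc _ tu1 Hu) (H1_lc _ tv1 Hv)))//.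
have : e / (4 * (c ^+ 2 + 1)) * (4 * (c ^+ 2 + 1)) = e by rewrite divfK// gt_eqF.
move: e1 uu' vv'; move: (e / _) (H1_sqnorm _) (H1_sqnorm _) => d x y d0 xd yd <-.
have c0 := sqr_ge0 c.
rewrite (@le_trans _ _ (2 * (c ^+ 2 * d + d)))//; last by move: c0; move: (c ^+ 2) => c2 c0; nra.
by rewrite ler_pM2l// lerD// ler_wpM2l.
Qed.

(** The left side is linear in [u] and, by Cauchy-Schwarz, continuous for the H^1 norm because [p]
    and [q] are square integrable. On test functions the chosen weak derivative equals the classical
    one almost everywhere, so density finishes. This is the one density argument behind the product
    rule. *)
Lemma H10_ext i p q : sq p -> sq q ->
  (forall v, test_function D v -> ip v p + ip (partial i v) q = 0) ->
  forall u, H10 D u -> ip u p + ip (wp i u) q = 0.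
Proof.
move=> sp sq' H0 u /H10P[Hu du]; pose T v := ip v p + ip (wp i v) q.
pose C := 2 * (ip p p + ip q q).
have C0 : 0 <= C by rewrite mulr_ge0// addr_ge0// ip_ge0.
have TC v : H1 D v -> T v ^+ 2 <= C * H1_sqnorm v.
  move=> Hv; have sv := H1_sqint Hv; have swv := H1_weak_partial_sqint i Hv.
  have := Cauchy_Schwarz_ip mD sv sp; have := Cauchy_Schwarz_ip mD swv sq'.
  have := ip_le_H1_sqnorm v; have := ip_weak_partial_le_H1_sqnorm i v.
  move=> h1 h2 h3 h4.
  have := ip_ge0 leb D p; have := ip_ge0 leb D q.
  have := sqr_ge0 (ip v p - ip (wp i v) q).
  rewrite /T /C; move: (ip v p) (ip (wp i v) q) (ip p p) (ip q q) (ip v v) h1 h2 h3 h4.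
  move=> a b P Q V; move: (ip (wp i v) (wp i v)) (H1_sqnorm v) => W N h1 h2 h3 h4 h5 h6 h7.
  have : V * P <= N * P by rewrite ler_wpM2r.
  have : W * Q <= N * Q by rewrite ler_wpM2r.
  nra.
have T0 v : test_function D v -> T v = 0.
  move=> tv; rewrite -(H0 _ tv) /T; congr (_ + _).
  have tw := test_function_weak_partial i tv.
  apply: (ae_eq_ip mD) => //.
  - by apply: H1_weak_partial_sqint; exact: test_function_H1.
  - exact: test_function_partial_sqint.
  - exact: weak_partial_ae.
  - exact: aeW.
rewrite -/(T u); apply/eqP; rewrite -sqrf_eq0 eq_le sqr_ge0 andbT.
apply/ler_addgt0Pl => e e0; rewrite addr0.
(* The value at [u] is that at [u - v], whose square is at most [C e / (C + 1) <= e]. *)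
have e1 : 0 < e / (C + 1) by rewrite divr_gt0// ltr_wpDl.
have [v tv uv] := du _ e1; have Hv := test_function_H1 tv.
have -> : T u = T (lincomb (-1) v u).
  have := T0 v tv; rewrite /T ip_weak_partial_lc// ip_lcl//; try exact: H1_sqint.
  move: (ip v p) (ip u p) (ip (wp i v) q) (ip (wp i u) q) => a1 a2 a3 a4.
  by move=> E; rewrite !mulN1r addrACA -opprD E oppr0 add0r.
rewrite (le_trans (TC _ (H1_lc _ Hv Hu)))//.
rewrite (le_trans (ler_wpM2l C0 uv))// mulrA ler_pdivrMr ?ltr_wpDl//.
by rewrite mulrDr mulr1 [C * e]mulrC lerDl ltW.
Qed.

Lemma H10_by_parts i u h : H10 D u -> C1_dir i h ->
  ip u (partial i h) + ip (wp i u) h = 0.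
Proof.
move=> Hu Ch; have [ch _ cdh] := Ch; apply: H10_ext Hu => //.
- exact: continuous_sqint.
- exact: continuous_sqint.
- by move=> v tv; rewrite (test_by_parts tv Ch) addNr.
Qed.

(** With [v] and [h] fixed, the identity is linear in [u] with the square-integrable coefficients
    [p = d_i h v + h d_i v] and [q = h v]. [H10_ext] thus reduces [u] to a test function [w]; then
    [w h] is an admissible multiplier and [H10_by_parts] applies to [v]. No membership of [u v] in
    H^1 is involved. *)
Lemma H10_mul_by_parts i u v h : H10 D u -> H10 D v -> C1_dir i h ->
  \int[leb]_(x in D) (u x * v x * partial i h x) =
  - \int[leb]_(x in D) ((wp i u x * v x + u x * wp i v x) * h x).
Proof.
move=> Hu Hv Ch; have [ch dh cdh] := Ch; have [H1u _] := Hu; have [H1v _] := Hv.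
have su := H1_sqint H1u; have swu := H1_weak_partial_sqint i H1u.
have sv := H1_sqint H1v; have swv := H1_weak_partial_sqint i H1v.
have s1 := sqintM_continuous cdh sv; have s2 := sqintM_continuous ch swv.
have s3 := sqintM_continuous ch sv.
have s12 := sqintD mD s1 s2.
have := @H10_ext i (fun x => partial i h x * v x + h x * wp i v x)
  (fun x => h x * v x) s12 s3.
have test w : test_function D w ->
    ip w (fun x => partial i h x * v x + h x * wp i v x) +
    ip (partial i w) (fun x => h x * v x) = 0.
  move=> tw; have Cw := test_function_C1_dir i tw; have [cw dw cdw] := Cw.
  have sw := test_function_sqint tw; have sdw := test_function_partial_sqint i tw.
  have := H10_by_parts Hv (C1_dirM Cw Ch); rewrite addrC => <-.
  have s4 := sqintM_continuous cw (continuous_sqint cdh).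
  have s5 := sqintM_continuous ch sdw.
  have E1 : ip v (partial i (fun x => w x * h x)) =
      ip v (fun x => w x * partial i h x) + ip v (fun x => h x * partial i w x).
    rewrite ![ip v _]ipC -(ipDl mD)//; apply: eq_Rintegral => x _.
    by rewrite partialM.
  rewrite E1 ipC (ipDl mD)// addrAC [RHS]addrC.
  by congr (_ + _ + _); apply: eq_Rintegral => x _; ring.
move=> /(_ test _ Hu) E.
have i1 := sqintM mD su s1; have i2 := sqintM mD su s2; have i3 := sqintM mD swu s3.
have E2 : ip u (fun x => partial i h x * v x + h x * wp i v x) =
    ip u (fun x => partial i h x * v x) + ip u (fun x => h x * wp i v x).
  by rewrite ![ip u _]ipC (ipDl mD).
rewrite E2 in E; apply/eqP; rewrite -addr_eq0; apply/eqP.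
rewrite -[RHS]E -addrA; congr (_ + _); first by apply: eq_Rintegral => x _; ring.
rewrite addrC /ip -RintegralD//.
by apply: eq_Rintegral => x _; ring.
Qed.

Lemma C1_dir_coord i : C1_dir i (fun x : 'rV[R]_n => x ord0 i).
Proof.
have D1 (x : 'rV[R]_n) : is_derive x (delta_mx ord0 i) (fun x : 'rV[R]_n => x ord0 i) 1.
  by have := @is_derive_coord R n id i i x 1 (is_derive_id _ _); rewrite eqxx.
split.
- by move=> x; exact: coord_continuous.
- by move=> x; have [] := D1 x.
- rewrite (_ : partial i _ = cst 1); first by move=> x; exact: cst_continuous.
  by apply/funext => x; rewrite /partial (@derive_val _ _ _ _ _ _ _ (D1 x)).
Qed.

Lemma partial_coord i (x : 'rV[R]_n) : partial i (fun x : 'rV[R]_n => x ord0 i) x = 1.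
Proof.
have := @is_derive_coord R n id i i x 1 (is_derive_id _ _); rewrite eqxx => D1.
by rewrite /partial (@derive_val _ _ _ _ _ _ _ D1).
Qed.

(* [int u^2 = - 2 int x_i u d_i u] *)
Lemma Poincare i : exists2 C, 0 <= C &
  forall u, H10 D u -> ip u u <= C * ip (wp i u) (wp i u).
Proof.
have [r r0 Dr] := bounded_rV_norm bD; exists (4 * r ^+ 2) => [|u Hu].
  by rewrite mulr_ge0// sqr_ge0.
have [H1u _] := Hu; have su := H1_sqint H1u; have swu := H1_weak_partial_sqint i H1u.
have Cx := C1_dir_coord i; have [cx _ _] := Cx.
pose xu (x : 'rV[R]_n) := x ord0 i * u x.
have sxu : sq xu := sqintM_continuous cx su.
have := H10_mul_by_parts Hu Hu Cx.
rewrite (_ : \int[leb]_(x in D) _ = ip u u); last first.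
  by apply: eq_Rintegral => x _; rewrite partial_coord mulr1.
rewrite (_ : \int[leb]_(x in D) _ = 2 * ip xu (wp i u)); last first.
  rewrite -RintegralZl//; last exact: sqintM.
  by apply: eq_Rintegral => x _; rewrite /xu; ring.
have xu_le : ip xu xu <= r ^+ 2 * ip u u.
  rewrite /ip -RintegralZl//; last exact: sqintM.
  apply: le_Rintegral => //; first exact: sqintM.
    by apply: rintegrableZ => //; exact: sqintM.
  move=> x Dx; rewrite mulrACA -!expr2 ler_wpM2r ?sqr_ge0//.
  rewrite -[leLHS]real_normK ?num_real// lerXn2r ?nnegrE ?(ltW r0)//.
  by rewrite (le_trans (ler_norm_coord _ _))// Dr.
have := Cauchy_Schwarz_ip mD sxu swu.
have := ip_ge0 leb D u; have := ip_ge0 leb D (wp i u); move: xu_le.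
move: (ip u u) (ip xu xu) (ip xu (wp i u)) (ip (wp i u) (wp i u)).
move=> A Y X W YA W0 A0 X2 AX.
(* With [A] for the integral of [u^2], one has [A^2 = 4 X^2 <= 4 Y W <= 4 r^2 A W]. Dividing by
   [A > 0] gives the constant [4 r^2]. *)
have [->|A1] := eqVneq A 0; first by rewrite mulr_ge0// mulr_ge0// sqr_ge0.
have {A1}A0 : 0 < A by rewrite lt_neqAle eq_sym A1.
rewrite -(ler_pM2l A0); have -> : A * A = 4 * X ^+ 2 by rewrite AX; ring.
rewrite (@le_trans _ _ (4 * (Y * W)))//; first by rewrite ler_pM2l.
have -> : A * (4 * r ^+ 2 * W) = 4 * (r ^+ 2 * A * W) by ring.
by rewrite ler_pM2l// ler_wpM2r.
Qed.

(** Riesz-Fischer gives limits [w] of the functions and [g i] of their derivatives. The definition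
    of a weak derivative pairs with fixed square-integrable functions, so it passes to the limit and
    makes [g i] a derivative of [w]. *)
Lemma H10_complete (u : nat -> 'rV[R]_n -> R) : (forall k, H10 D (u k)) ->
  (forall e, 0 < e -> exists K, forall k l, (K <= k)%N -> (K <= l)%N ->
    H1_sqnorm (lincomb (-1) (u l) (u k)) <= e) ->
  exists2 w, H10 D w & forall e, 0 < e -> exists K, forall k, (K <= k)%N ->
    H1_sqnorm (lincomb (-1) w (u k)) <= e.
Proof.
move=> Hu cu; have H1u k : H1 D (u k) by case: (Hu k).
have su k := H1_sqint (H1u k); have swu k i := H1_weak_partial_sqint i (H1u k).
have dE f g : lincomb (-1) g f = (fun x => f x - g x).
  by apply/funext => x; rewrite /lincomb mulN1r addrC.
have [w sw Hw] : exists2 w, sq w & forall e, 0 < e -> exists K, forall k, (K <= k)%N ->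
    ip (lincomb (-1) w (u k)) (lincomb (-1) w (u k)) <= e.
  have [|w sw Hw] := Riesz_Fischer mD su.
    move=> e e0; have [K HK] := cu e e0; exists K => k l Kk Kl.
    by rewrite -dE (le_trans _ (HK k l Kk Kl))// ip_le_H1_sqnorm.
  by exists w => // e e0; have [K HK] := Hw e e0; exists K => k /HK; rewrite -dE.
have /choice[g Hg] : forall i, exists g, sq g /\ forall e, 0 < e ->
    exists K, forall k, (K <= k)%N ->
    ip (lincomb (-1) g (wp i (u k))) (lincomb (-1) g (wp i (u k))) <= e.
  move=> i; have [|g sg Hg] := Riesz_Fischer mD (swu ^~ i).
    move=> e e0; have [K HK] := cu e e0; exists K => k l Kk Kl.
    rewrite -dE (le_trans _ (HK k l Kk Kl))//.
    rewrite (le_trans _ (ip_weak_partial_le_H1_sqnorm i _))//.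
    have Hl := H1_lc (-1) (H1u l) (H1u k).
    have s1 := sqint_lc (-1) (swu l i) (swu k i); have s2 := H1_weak_partial_sqint i Hl.
    have E := weak_partial_lc i (-1) (H1u l) (H1u k).
    by rewrite (ae_eq_ip mD s2 s1 s2 s1 E E).
  by exists g; split=> // e e0; have [K HK] := Hg e e0; exists K => k /HK; rewrite -dE.
have sg i : sq (g i) by case: (Hg i).
have wg i : is_weak_partial D i w (g i).
  split; try exact: sqint_locally_integrable.
  move=> v tv; have sv := test_function_sqint tv; have sdv := test_function_partial_sqint i tv.
  rewrite -[LHS]/(ip w (partial i v)) -[RHS]/(- ip (g i) v).
  apply/eqP; rewrite -addr_eq0 -sqrf_eq0 eq_le sqr_ge0 andbT.
  apply/ler_addgt0Pl => e e0; rewrite addr0.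
  (* The defect is [-(X + Y)] with [X^2 <= A P], [Y^2 <= B V] and [A, B <= d]. Its square is at most
     [2 d (P + V) = d C], hence at most [d (C + 1) = e]. *)
  have [C CE] : exists C, C = 2 * (ip (partial i v) (partial i v) + ip v v) by eexists.
  have C0 : 0 <= C by rewrite CE mulr_ge0// addr_ge0// ip_ge0.
  have [d d0 dC] : exists2 d, 0 < d & d * (C + 1) = e.
    exists (e / (C + 1)); first by rewrite divr_gt0// ltr_wpDl.
    by rewrite divfK// gt_eqF// ltr_wpDl.
  have [K1 HK1] := Hw _ d0; have [K2 HK2] := (Hg i).2 _ d0.
  pose k := maxn K1 K2; have := HK1 k (leq_maxl _ _); have := HK2 k (leq_maxr _ _).
  have sa := sqint_lc (-1) sw (su k); have sb := sqint_lc (-1) (sg i) (swu k i).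
  have [_ _ /(_ _ tv)] := H1_weak_partial i (H1u k).
  rewrite -[X in X = _ -> _]/(ip (u k) (partial i v)) -[X in _ = - X -> _]/(ip (wp i (u k)) v).
  move=> E.
  have -> : ip w (partial i v) + ip (g i) v =
      - (ip (lincomb (-1) w (u k)) (partial i v) + ip (lincomb (-1) (g i) (wp i (u k))) v).
    by rewrite !ip_lcl// E; ring.
  have := Cauchy_Schwarz_ip mD sa sdv; have := Cauchy_Schwarz_ip mD sb sv.
  clear sa sb E.
  have := ip_ge0 leb D (partial i v); have := ip_ge0 leb D v.
  move: (lincomb (-1) w (u k)) (lincomb (-1) (g i) (wp i (u k))) => a b.
  move: CE; move: (ip a (partial i v)) (ip b v) (ip a a) (ip b b) => X Y A B.
  move: (ip v v) (ip (partial i v) (partial i v)) => V P CE.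
  move=> V0 P0 Y2 X2 Bd Ad; have := sqr_ge0 (X - Y); rewrite -dC CE.
  have : B * V <= d * V by rewrite ler_wpM2r.
  have : A * P <= d * P by rewrite ler_wpM2r.
  nra.
have H1w : H1 D w by exact: H1_intro sw wg sg.
have cvg e : 0 < e -> exists K, forall k, (K <= k)%N ->
    H1_sqnorm (lincomb (-1) w (u k)) <= e.
  (* The squared norm has [n + 1] terms: the function and its [n] derivatives. *)
  move=> e0; have d0 : 0 < e / n.+1%:R by rewrite divr_gt0.
  have [K0 HK0] := Hw _ d0.
  have /choice[K HK] : forall i, exists K, forall k, (K <= k)%N ->
      ip (lincomb (-1) (g i) (wp i (u k))) (lincomb (-1) (g i) (wp i (u k))) <= e / n.+1%:R.
    by move=> i; exact: (Hg i).2.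
  exists (maxn K0 (\max_(i < n) K i)) => k; rewrite geq_max => /andP[k0 /bigmax_leqP kK].
  have -> : e = e / n.+1%:R + \sum_(i < n) (e / n.+1%:R).
    by rewrite sumr_const card_ord -mulrS -[RHS](mulr_natr _ n.+1) divfK.
  apply: lerD; first exact: HK0.
  apply: ler_sum => i _; have := HK i k (kK i isT).
  have Hl := H1_lc (-1) H1w (H1u k); have swl := H1_weak_partial_sqint i Hl.
  have sl := sqint_lc (-1) (sg i) (swu k i).
  have E : wp i (lincomb (-1) w (u k)) = lincomb (-1) (g i) (wp i (u k)) %[ae leb in D].
    by apply: weak_partial_ae => //; apply: is_weak_partial_lc => //; exact: H1_weak_partial.
  by rewrite (ae_eq_ip mD swl sl swl sl E E).
exists w => //; apply/H10P; split=> // e e0.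
have e4 : 0 < e / 4 by rewrite divr_gt0.
have [K HK] := cvg _ e4; have /H10P[_ /(_ _ e4)[v tv uv]] := Hu K.
exists v => //; have H1v := test_function_H1 tv.
(* [w - v = (u_K - v) - (u_K - w)], both parts having squared norm at most [e / 4]; [H1_sqnorm_lc]
   doubles the sum. *)
have -> : lincomb (-1) v w = lincomb (-1) (lincomb (-1) w (u K)) (lincomb (-1) v (u K)).
  by apply/funext => x; rewrite /lincomb; ring.
rewrite (le_trans (H1_sqnorm_lc _ (H1_lc _ H1w (H1u K)) (H1_lc _ H1v (H1u K))))//.
have := HK K (leqnn _); move: (H1_sqnorm _) (H1_sqnorm _) uv => x y; lra.
Qed.


End Sobolev_space.

(** * The energy form *)

Lemma dotv_actv (R : realType) (n : nat) (A : 'M[R]_n) (u v : 'rV[R]_n) :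
  dotv (actv A u) v = \sum_(i < n) \sum_(j < n) A i j * u ord0 j * v ord0 i.
Proof.
rewrite /dotv mxE; apply: eq_bigr => i _; rewrite !mxE mulr_suml.
by apply: eq_bigr => j _; rewrite !mxE.
Qed.

Lemma dotv_scalar (R : realType) (n : nat) (c : R) (v : 'rV[R]_n) :
  dotv (actv c%:M v) v = \sum_(i < n) c * v ord0 i ^+ 2.
Proof.
rewrite dotv_actv; apply: eq_bigr => i _; rewrite (bigD1 i)//= big1 => [|j ji].
  by rewrite mxE eqxx addr0 -mulrA expr2.
by rewrite mxE eq_sym (negbTE ji) !mul0r.
Qed.

Section elliptic_form.
Variables (R : realType) (n : nat) (D : set 'rV[R]_n).
Hypotheses (oD : open D) (bD : bounded_set D) (n_gt0 : (0 < n)%N).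
Variables (beta : 'rV[R]_n -> 'M[R]_n) (m M B : R).
Hypothesis m_gt0 : 0 < m.
Hypothesis beta_sym : forall x, D x -> (beta x)^T = beta x.
Hypothesis beta_measurable : forall i j, measurable_fun D (fun x => beta x i j).
Hypothesis beta_bounded : forall i j x, D x -> `|beta x i j| <= B.
Hypothesis beta_lower : forall x, D x -> loewner_le m%:M (beta x).
Hypothesis beta_upper : forall x, D x -> loewner_le (beta x) M%:M.
Implicit Types (u v w p : 'rV[R]_n -> R) (i j : 'I_n) (q : 'I_n -> 'rV[R]_n -> R).
Local Notation leb := (lebesgue_rV R n).
Local Notation ip := (ip leb D).
Local Notation sq := (sqint leb D).
Local Notation wp := (weak_partial D).

Let mD : measurable D. Proof. exact: open_rV_measurable. Qed.

(** Expanding into inner products lets almost-everywhere linearity of [weak_partial] enter through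
    [ip_weak_partial_lc]; [energy_formE] returns to the single integral. *)
Definition energy_form u v : R :=
  \sum_(i < n) \sum_(j < n) ip (fun x => beta x i j * wp j u x) (wp i v).

Let sqint_beta i j u : sq u -> sq (fun x => beta x i j * u x).
Proof.
by apply: (sqintM_bounded mD (C := B)); [exact: beta_measurable|exact: beta_bounded].
Qed.

Let rintegrable_energy i j u v : H1 D u -> H1 D v ->
  rintegrable leb D (fun x => beta x i j * wp j u x * wp i v x).
Proof.
move=> Hu Hv; apply: (sqintM mD (u := fun x => beta x i j * wp j u x)).
  by apply: sqint_beta; exact: H1_weak_partial_sqint.
exact: H1_weak_partial_sqint.
Qed.

Lemma rintegrable_dotv u v : H1 D u -> H1 D v -> rintegrable leb D
  (fun x => dotv (actv (beta x) (weak_grad D u x)) (weak_grad D v x)).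
Proof.
move=> Hu Hv; apply: (rintegrable_eq mD
  (f := fun x => \sum_(i < n) \sum_(j < n) beta x i j * wp j u x * wp i v x)).
  move=> x _; rewrite dotv_actv; apply: eq_bigr => i _; apply: eq_bigr => j _.
  by rewrite !mxE.
apply: rintegrable_sum => // i; apply: rintegrable_sum => // j.
exact: rintegrable_energy.
Qed.

Lemma energy_formE u v : H1 D u -> H1 D v ->
  \int[leb]_(x in D)
    dotv (actv (beta x) (weak_grad D u x)) (weak_grad D v x) = energy_form u v.
Proof.
move=> Hu Hv; rewrite /energy_form.
transitivity (\int[leb]_(x in D) (\sum_(i < n) \sum_(j < n)
    beta x i j * wp j u x * wp i v x)).
  apply: eq_Rintegral => x _; rewrite dotv_actv; apply: eq_bigr => i _.
  by apply: eq_bigr => j _; rewrite !mxE.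
rewrite Rintegral_sum// => [|i]; last first.
  by apply: rintegrable_sum => // j; exact: rintegrable_energy.
apply: eq_bigr => i _; rewrite Rintegral_sum// => j.
exact: rintegrable_energy.
Qed.

Lemma energy_form_lc c u v w : H1 D u -> H1 D v -> H1 D w ->
  energy_form (lincomb c u v) w = c * energy_form u w + energy_form v w.
Proof.
move=> Hu Hv Hw; rewrite /energy_form mulr_sumr -big_split; apply: eq_bigr => i _.
rewrite /= mulr_sumr -big_split; apply: eq_bigr => j _ /=.
(* Moving [beta] to the second factor leaves a bare weak derivative in the linear slot. *)
have shift f : ip (fun x => beta x i j * f x) (wp i w) =
    ip f (fun x => beta x i j * wp i w x).
  by apply: eq_Rintegral => x _; rewrite mulrCA mulrA.
rewrite !shift ip_weak_partial_lc//; apply: sqint_beta.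
exact: H1_weak_partial_sqint.
Qed.

Lemma energy_formC u v : energy_form u v = energy_form v u.
Proof.
rewrite /energy_form [LHS]exchange_big /=; apply: eq_bigr => j _; apply: eq_bigr => i _.
apply: eq_Rintegral => x /set_mem Dx; rewrite -[in LHS](beta_sym Dx) mxE.
by rewrite [LHS]mulrAC.
Qed.

Let rintegrable_sqr c u : H1 D u ->
  rintegrable leb D (fun x => dotv (actv c%:M (weak_grad D u x)) (weak_grad D u x)).
Proof.
move=> Hu; apply: (rintegrable_eq mD
    (f := fun x => \sum_(i < n) c * (wp i u x * wp i u x))).
  by move=> x _; rewrite dotv_scalar; apply: eq_bigr => i _; rewrite !mxE expr2.
apply: rintegrable_sum => // i; apply: rintegrableZ => //.
by apply: sqintM => //; exact: H1_weak_partial_sqint.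
Qed.

Let Rintegral_sqr c u : H1 D u ->
  \int[leb]_(x in D) dotv (actv c%:M (weak_grad D u x)) (weak_grad D u x) =
  c * \sum_(i < n) ip (wp i u) (wp i u).
Proof.
move=> Hu; have iu i : rintegrable leb D (fun x => wp i u x * wp i u x).
  by apply: sqintM => //; exact: H1_weak_partial_sqint.
transitivity (\int[leb]_(x in D) (\sum_(i < n) c * (wp i u x * wp i u x))).
  by apply: eq_Rintegral => x _; rewrite dotv_scalar; apply: eq_bigr => i _; rewrite !mxE expr2.
rewrite Rintegral_sum// => [|i]; last exact: rintegrableZ.
by rewrite mulr_sumr; apply: eq_bigr => i _; apply: RintegralZl => //; exact: iu.
Qed.

Lemma energy_form_ge u : H1 D u ->
  m * \sum_(i < n) ip (wp i u) (wp i u) <= energy_form u u.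
Proof.
move=> Hu; rewrite -energy_formE// -Rintegral_sqr//.
apply: le_Rintegral => //; first exact: rintegrable_sqr.
  exact: rintegrable_dotv.
by move=> x Dx; exact: beta_lower.
Qed.

Lemma energy_form_le u : H1 D u ->
  energy_form u u <= M * \sum_(i < n) ip (wp i u) (wp i u).
Proof.
move=> Hu; rewrite -energy_formE// -Rintegral_sqr//.
apply: le_Rintegral => //; first exact: rintegrable_dotv.
  exact: rintegrable_sqr.
by move=> x Dx; exact: beta_upper.
Qed.

(** Coercivity. The Poincare inequality in one coordinate, available as [0 < n], bounds the squared
    norm by [C + 1] times the gradient part, which costs a factor [1 / m] in terms of energy. *)
Lemma H1_sqnorm_le_energy : exists2 C, 0 <= C &
  forall u, H10 D u -> H1_sqnorm D u <= C * energy_form u u.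
Proof.
have [C C0 HC] := Poincare oD bD (Ordinal n_gt0).
exists ((C + 1) / m) => [|u Hu]; first by rewrite divr_ge0 ?addr_ge0// ltW.
have [H1u _] := Hu; rewrite mulrAC ler_pdivlMr// mulrC.
rewrite (@le_trans _ _ ((C + 1) * (m * \sum_(i < n) ip (wp i u) (wp i u))))//.
  rewrite mulrCA ler_wpM2l ?(ltW m_gt0)// mulrDl mul1r lerD2r.
  rewrite (le_trans (HC u Hu))// ler_wpM2l//.
  by rewrite (bigD1 (Ordinal n_gt0))//= lerDl sumr_ge0// => *; exact: ip_ge0.
by rewrite ler_wpM2l ?addr_ge0//; exact: energy_form_ge.
Qed.

(** The general shape of the right-hand side: square-integrable data paired with the function and
    with its derivatives. *)
Definition functional p q u : R := ip u p + \sum_(i < n) ip (wp i u) (q i).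

Lemma functional_lc p q c u v : sq p -> (forall i, sq (q i)) ->
  H1 D u -> H1 D v ->
  functional p q (lincomb c u v) = c * functional p q u + functional p q v.
Proof.
move=> sp sq' Hu Hv; rewrite /functional ip_lcl//; try exact: H1_sqint.
rewrite mulrDr addrACA; congr (_ + _); rewrite mulr_sumr -big_split.
by apply: eq_bigr => i _ /=; rewrite ip_weak_partial_lc.
Qed.

Lemma functional_bounded p q : sq p -> (forall i, sq (q i)) ->
  exists2 C, 0 <= C &
  forall u, H1 D u -> functional p q u ^+ 2 <= C * H1_sqnorm D u.
Proof.
move=> sp sq'; pose K := Num.sqrt (ip p p) + \sum_(i < n) Num.sqrt (ip (q i) (q i)).
have K0 : 0 <= K by rewrite addr_ge0 ?sumr_ge0// => *; exact: sqrtr_ge0.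
exists (K ^+ 2) => [|u Hu]; first exact: sqr_ge0.
have bound g r : sq g -> sq r -> ip g g <= H1_sqnorm D u ->
    `|ip g r| <= Num.sqrt (H1_sqnorm D u) * Num.sqrt (ip r r).
  move=> sg sr gu; rewrite -sqrtrM ?H1_sqnorm_ge0// -sqrtr_sqr ler_wsqrtr//.
  by rewrite (le_trans (Cauchy_Schwarz_ip mD sg sr))// ler_wpM2r// ip_ge0.
have : `|functional p q u| <= Num.sqrt (H1_sqnorm D u) * K.
  rewrite (le_trans (ler_normD _ _))// mulrDr; apply: lerD.
    by apply: bound => //; [exact: H1_sqint|exact: ip_le_H1_sqnorm].
  rewrite (le_trans (ler_norm_sum _ _ _))// mulr_sumr; apply: ler_sum => i _.
  apply: bound => //; first exact: H1_weak_partial_sqint.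
  exact: ip_weak_partial_le_H1_sqnorm.
move=> h; rewrite -[leLHS]real_normK ?num_real//.
rewrite (@le_trans _ _ ((Num.sqrt (H1_sqnorm D u) * K) ^+ 2))//.
  by rewrite lerXn2r// nnegrE mulr_ge0// sqrtr_ge0.
by rewrite exprMn sqr_sqrtr ?H1_sqnorm_ge0// mulrC.
Qed.

Lemma test_function0 : test_function D (cst 0).
Proof.
split; first by move=> k; exact: Ck_cst.
by exists set0; split => //; exact: compact0.
Qed.

Lemma H10_cst0 : H10 D (cst 0).
Proof.
have t0 := test_function0; have H0 := test_function_H1 oD bD t0.
apply/H10P => //; split=> // e e0; exists (cst 0) => //.
have -> : lincomb (-1) (cst 0) (cst 0) = cst 0 :> ('rV[R]_n -> R).
  by apply/funext => x; rewrite /lincomb mulr0 addr0.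
have s0 : sq (cst 0) by exact: H1_sqint.
have ip0 : ip (cst 0) (cst 0) = 0.
  by rewrite /ip; under eq_Rintegral do rewrite mulr0; rewrite Rintegral_cst ?mul0r.
rewrite /H1_sqnorm ip0 add0r big1 ?(ltW e0)// => i _; rewrite -[RHS]ip0.
have sw := H1_weak_partial_sqint oD i H0.
have E : wp i (cst 0) = cst 0 %[ae leb in D].
  have E0 : partial i (cst 0) = cst 0 :> ('rV[R]_n -> R).
    by apply/funext => x; rewrite /partial derive_cst.
  rewrite -[X in _ = X %[ae leb in D]]E0.
  by apply: weak_partial_ae => //; exact: test_function_weak_partial.
exact: (ae_eq_ip mD sw s0 sw s0 E E).
Qed.

(** The lower and upper bounds on [beta] make the energy equivalent to the squared H^1 norm on
    H^1_0, so completeness transfers. The constant [C2 * C1] combines continuity of the functional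
    with coercivity. *)
Lemma energy_form_solution p q : sq p -> (forall i, sq (q i)) ->
  exists2 u, H10 D u & forall v, H10 D v -> energy_form u v = functional p q v.
Proof.
move=> sp sq'; have [C1 C10 HC1] := H1_sqnorm_le_energy.
have [C2 C20 HC2] := functional_bounded sp sq'.
have H1of u : H10 D u -> H1 D u by case.
have M0 : 0 <= `|M| by [].
apply: (@symmetric_Lax_Milgram R _ (@lincomb R n) (H10 D) energy_form
  (functional p q) _ _ _ _ _ _ (C2 * C1)).
- by move=> c u v; exact: H10_lc.
- by exists (cst 0); exact: H10_cst0.
- by move=> u v _ _; exact: energy_formC.
- by move=> c u v w /H1of Hu /H1of Hv /H1of Hw; exact: energy_form_lc.
- move=> u Hu; rewrite (le_trans _ (energy_form_ge (H1of _ Hu)))//.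
  by rewrite mulr_ge0 ?(ltW m_gt0)// sumr_ge0// => *; exact: ip_ge0.
- by move=> c u v /H1of Hu /H1of Hv; exact: functional_lc.
- by rewrite mulr_ge0.
- move=> u Hu; rewrite (le_trans (HC2 _ (H1of _ Hu)))// -mulrA ler_wpM2l//.
  exact: HC1.
move=> u Hu cu.
have [|w Hw cw] := H10_complete oD bD Hu.
  move=> e e0; have e1 : 0 < e / (C1 + 1) by rewrite divr_gt0// ltr_wpDl.
  have [K HK] := cu _ e1; exists K => k l Kk Kl.
  rewrite (le_trans (HC1 _ (H10_lc oD bD _ (Hu l) (Hu k))))//.
  rewrite (le_trans (ler_wpM2l C10 (HK k l Kk Kl)))// mulrA ler_pdivrMr ?ltr_wpDl//.
  by rewrite mulrDr mulr1 [C1 * e]mulrC lerDl ltW.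
(* The absolute value keeps the factor nonnegative, as no sign of [M] is assumed in this section. *)
exists w => // e e0; have e1 : 0 < e / (`|M| + 1) by rewrite divr_gt0// ltr_wpDl.
have [K HK] := cw _ e1; exists K => k Kk.
have H1d := H1_lc oD (-1) (H1of _ Hw) (H1of _ (Hu k)).
rewrite (le_trans (energy_form_le H1d))//.
rewrite (@le_trans _ _ (`|M| * H1_sqnorm D (lincomb (-1) w (u k))))//.
  rewrite (@le_trans _ _ (`|M| * \sum_(i < n) ip (wp i (lincomb (-1) w (u k)))
      (wp i (lincomb (-1) w (u k)))))//.
    by rewrite ler_wpM2r ?ler_norm// sumr_ge0// => *; exact: ip_ge0.
  by rewrite ler_wpM2l// lerDr ip_ge0.
rewrite (le_trans (ler_wpM2l M0 (HK k Kk)))// mulrA ler_pdivrMr ?ltr_wpDl//.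
by rewrite mulrDr mulr1 [`|M| * e]mulrC lerDl ltW.
Qed.

(** The difference of two solutions has zero energy, hence zero H^1 norm by coercivity. Only the
    agreement with a common [F] matters. *)
Lemma energy_form_unique (F : ('rV[R]_n -> R) -> R) u v : H10 D u -> H10 D v ->
  (forall w, H10 D w -> energy_form u w = F w) ->
  (forall w, H10 D w -> energy_form v w = F w) ->
  u = v %[ae leb in D].
Proof.
move=> Hu Hv HuF HvF; have [H1u _] := Hu; have [H1v _] := Hv.
have Hw := H10_lc oD bD (-1) Hv Hu; have [H1w _] := Hw.
have [C C0 HC] := H1_sqnorm_le_energy.
have w0 : energy_form (lincomb (-1) v u) (lincomb (-1) v u) = 0.
  by rewrite energy_form_lc// HuF// HvF// mulN1r addNr.
have := HC _ Hw; rewrite w0 mulr0 => N0.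
have ip0 : ip (lincomb (-1) v u) (lincomb (-1) v u) = 0.
  by apply/eqP; rewrite eq_le ip_ge0 andbT (le_trans (ip_le_H1_sqnorm D _)).
have := ip_eq0 mD (H1_sqint oD H1w) ip0; apply: filterS => x + Dx => /(_ Dx).
by rewrite /lincomb mulN1r addrC => /eqP; rewrite subr_eq0 => /eqP.
Qed.

End elliptic_form.

(** * The interface term *)

Lemma near_eq_continuous_at (T U : topologicalType) (f g : T -> U) (x : T) :
  (\forall y \near x, f y = g y) -> {for x, continuous f} -> {for x, continuous g}.
Proof.
move=> fg; rewrite /prop_for /continuous_at -(nbhs_singleton fg) => cf.
by apply: cvg_trans cf; apply: near_eq_cvg; apply: filterS fg => y ->.
Qed.

Section extends_continuously.
Variables (R : realType) (n : nat) (E : set 'rV[R]_n).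
Hypotheses (oE : open E) (bE : bounded_set E).
Implicit Types (f : 'rV[R]_n -> R).

Lemma compact_closure_rV : compact (closure E).
Proof.
have [r _ Er] := bounded_rV_norm bE.
apply: (subclosed_compact (@closed_closure _ E) (@ball_rV_compact R n r)).
rewrite [X in _ `<=` X](closure_id _).1; first exact: closure_subset.
by apply: compact_closed; [exact: norm_hausdorff|exact: ball_rV_compact].
Qed.

Lemma extends_continuously_bounded f : extends_continuously E f ->
  exists C, forall x, E x -> `|f x| <= C.
Proof.
move=> [g [cg gf]]; have [C HC] := continuous_compact_bounded compact_closure_rV cg.
by exists C => x Ex; rewrite -gf// HC//; exact: subset_closure.
Qed.

Lemma C1_closure_bounded i f : C1_closure E f -> exists C, forall x, E x ->
  `|f x| <= C /\ `|partial i f x| <= C.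
Proof.
move=> [_ /extends_continuously_bounded[C1 H1] /(_ i)/extends_continuously_bounded[C2 H2]].
by exists (Num.max C1 C2) => x Ex; rewrite !le_max H1// H2// orbT.
Qed.

Lemma C1_closure_measurable f : C1_closure E f -> measurable_fun E f.
Proof. by move=> [[cf _] _ _]; exact: continuous_measurable_rV. Qed.

Lemma C1_closure_partial_measurable i f : C1_closure E f ->
  measurable_fun E (partial i f).
Proof.
by move=> [[_ /(_ i)[_ [cdf _]]] _ _]; exact: continuous_measurable_rV.
Qed.

(** [C1_closure] says nothing about the values of [f] on the boundary. When these are the limits
    from [E], they coincide with those of the continuous extension by uniqueness of limits, so [f]
    is measurable and bounded up to the boundary. *)
Lemma C1_closure_extend f : C1_closure E f ->
  (forall x, bdry E x -> f @ within E (nbhs x) --> f x) ->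
  measurable_fun (closure E) f /\ exists C, forall x, closure E x -> `|f x| <= C.
Proof.
move=> [_ [g [cg gf]] _] fE.
have fg x : closure E x -> g x = f x.
  move=> cEx; have [Ex|nEx] := pselect (E x); first exact: gf.
  have bx : bdry E x by split => //; rewrite (interior_id _).1.
  have PF : ProperFilter (within E (nbhs x)) by exact: within_nbhs_proper.
  apply: (@cvg_unique _ (@norm_hausdorff _ _) (g @ within E (nbhs x))).
    have /subspace_continuousP/(_ x cEx) := cg.
    apply: cvg_trans; apply: cvg_app; apply: within_subset.
    exact: subset_closure.
  apply: cvg_trans (fE x bx); apply: near_eq_cvg.
  by apply: filterS (withinT E _) => y Ey; rewrite gf.
have mcE : measurable (closure E) by apply: closed_rV_measurable; exact: closed_closure.
split.
  apply: (@eq_measurable_fun _ _ _ _ _ g); first by move=> x /set_mem /fg.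
  exact: within_continuous_measurable_rV.
have [C HC] := continuous_compact_bounded compact_closure_rV cg.
by exists C => x cEx; rewrite -fg// HC.
Unshelve. all: by end_near. Qed.

End extends_continuously.

(** * Weak divergence of [b psi n] on the inner domain *)

Section weak_divergence.
Variables (R : realType) (n : nat) (D E : set 'rV[R]_n).
Hypotheses (oD : open D) (bD : bounded_set D) (oE : open E) (ED : E `<=` D).
Implicit Types (u v w b psi nu : 'rV[R]_n -> R) (i : 'I_n).
Local Notation leb := (lebesgue_rV R n).
Local Notation ip := (ip leb D).
Local Notation sq := (sqint leb D).
Local Notation wp := (weak_partial D).

Let mD : measurable D. Proof. exact: open_rV_measurable. Qed.
Let mE : measurable E. Proof. exact: open_rV_measurable. Qed.
Let bE : bounded_set E. Proof.
by case: bD => M [Mr HM]; exists M; split=> // r /HM Hr x /ED /Hr.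
Qed.

(** A test function on [E] vanishes off a compact [K] inside [E]. Every point is in the open set
    [E], where the product is C^1, or in the open complement of [K], where it is zero. *)
Lemma C1_dir_cutoff i nu v : Ck 1 E nu -> test_function E v ->
  C1_dir i ((fun x => nu x * v x) \_ E) /\
  (forall x, E x -> partial i ((fun x => nu x * v x) \_ E) x =
    nu x * partial i v x + v x * partial i nu x).
Proof.
move=> [cnu /(_ i)[dnu [cdnu _]]] tv; have [cv dv cdv] := test_function_C1_dir i tv.
have [_ [K [cK KE v0]]] := tv.
have oK : open (~` K) by apply: closed_openC; apply: compact_closed cK; exact: norm_hausdorff.
set F := _ \_ E.
have F0 x : ~ K x -> F x = 0.
  by move=> Kx; rewrite /F patchE; case: ifP => // _; rewrite v0 ?mulr0.
have nearE x : E x -> \forall y \near x, nu y * v y = F y.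
  move=> Ex; apply: filterS (open_nbhs_nbhs (conj oE Ex)) => y Ey.
  by rewrite /F patchE mem_set.
have nearK x : ~ K x -> \forall y \near x, F y = 0.
  by move=> Kx; apply: filterS (open_nbhs_nbhs (conj oK Kx)) => y; exact: F0.
have cases x : E x \/ ~ K x by have [/KE|] := pselect (K x); [left|right].
have dFE x : E x -> partial i F x = nu x * partial i v x + v x * partial i nu x.
  move=> Ex; rewrite -partialM//; last exact: dnu.
  by apply/esym; exact: near_eq_derive (nearE x Ex).
have dF0 := partial_out i oK F0.
split=> //; split.
- move=> x; have [Ex|Kx] := cases x.
    exact: (near_eq_continuous_at (nearE x Ex) (cvgM (cnu x Ex) (cv x))).
  apply: (@near_eq_continuous_at _ _ (cst 0)); last exact: cst_continuous.
  by apply: filterS (nearK x Kx) => y ->.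
- move=> x; have [Ex|Kx] := cases x.
    apply: (near_eq_derivable (nearE x Ex)).
    by apply: derivableM; [exact: dnu|exact: dv].
  apply: (@near_eq_derivable _ _ _ (cst 0)); last exact: derivable_cst.
  by apply: filterS (nearK x Kx) => y ->.
- move=> x; have [Ex|Kx] := cases x.
    have dE : \forall y \near x,
        nu y * partial i v y + v y * partial i nu y = partial i F y.
      by apply: filterS (open_nbhs_nbhs (conj oE Ex)) => y Ey; rewrite dFE.
    exact: (near_eq_continuous_at dE
      (cvgD (cvgM (cnu x Ex) (cdv x)) (cvgM (cv x) (cdnu x Ex)))).
  apply: (@near_eq_continuous_at _ _ (cst 0)); last exact: cst_continuous.
  by apply: filterS (open_nbhs_nbhs (conj oK Kx)) => y Ky; rewrite dF0.
Qed.

Let rintegrable_E u : rintegrable leb D u -> rintegrable leb E u.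
Proof. exact: integrableS. Qed.

Let rintegrable_locally_integrable u : rintegrable leb E u -> locally_integrable_on E u.
Proof.
move=> iu; split; first exact: rintegrable_measurable iu.
move=> K KE cK; have mK := compact_rV_measurable cK.
by have /integrableP[] := integrableS mE mK KE iu.
Qed.

(** The Leibniz rule for [b psi nu], with weak derivatives of [b] and [psi] in the whole of [D] and
    the classical one of [nu] in [E]. *)
Definition product_partial i b psi nu : 'rV[R]_n -> R := fun x =>
  (wp i b x * psi x + b x * wp i psi x) * nu x + b x * psi x * partial i nu x.

Let rintegrable_mulE u (c : 'rV[R]_n -> R) (C : R) : rintegrable leb D u -> measurable_fun E c ->
  (forall x, E x -> `|c x| <= C) -> rintegrable leb E (fun x => u x * c x).
Proof.
move=> iu mc cC; apply: (rintegrable_eq mE (f := fun x => c x * u x)).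
  by move=> x _; rewrite mulrC.
by apply: (rintegrable_bounded mE mc cC); exact: rintegrable_E.
Qed.

(** Apply [H10_mul_by_parts] in [D] with multiplier [nu v] cut off outside [E], then expand its
    derivative. All integrands vanish off a compact subset of [E], so the integrals over [D] are
    integrals over [E]. *)
Lemma weak_partial_product i b psi nu : H10 D b -> H10 D psi -> C1_closure E nu ->
  rintegrable leb E (product_partial i b psi nu) /\
  is_weak_partial E i (fun x => b x * psi x * nu x) (product_partial i b psi nu).
Proof.
move=> Hb Hpsi Cnu; have [H1b _] := Hb; have [H1psi _] := Hpsi.
have [C HC] := C1_closure_bounded bE i Cnu.
have nuC x : E x -> `|nu x| <= C by move=> /HC[].
have dnuC x : E x -> `|partial i nu x| <= C by move=> /HC[].
have mnu := C1_closure_measurable oE Cnu.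
have mdnu := C1_closure_partial_measurable oE i Cnu.
have sb := H1_sqint oD H1b; have swb := H1_weak_partial_sqint oD i H1b.
have sp := H1_sqint oD H1psi; have swp := H1_weak_partial_sqint oD i H1psi.
have i0 : rintegrable leb D (fun x => b x * psi x) by exact: sqintM.
have i1 : rintegrable leb D (fun x => wp i b x * psi x + b x * wp i psi x).
  by apply: rintegrableD => //; exact: sqintM.
have iA : rintegrable leb E (fun x => b x * psi x * nu x) by exact: rintegrable_mulE nuC.
have iB := rintegrable_mulE i1 mnu nuC.
have iC := rintegrable_mulE i0 mdnu dnuC.
have ip_ : rintegrable leb E (product_partial i b psi nu) by exact: (rintegrableD mE iB iC).
split=> //; split; try exact: rintegrable_locally_integrable.
move=> v tv; have [Cnu1 _ _] := Cnu.
have [CF dF] := C1_dir_cutoff i Cnu1 tv; set F := _ \_ E in CF dF.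
have [K [C' [cK KE v0 dv0 HC']]] := test_function_bounds i tv.
have oK : open (~` K) by apply: closed_openC; apply: compact_closed cK; exact: norm_hausdorff.
have FK x : ~ K x -> F x = 0.
  by move=> Kx; rewrite /F patchE; case: ifP => // _; rewrite v0 ?mulr0.
have dFK := partial_out i oK FK.
have := H10_mul_by_parts oD bD Hb Hpsi CF.
have toE G : (forall x, ~ K x -> G x = 0) ->
    \int[leb]_(x in D) G x = \int[leb]_(x in E) G x.
  by move=> G0; rewrite !(@Rintegral_supp _ _ _ K)//; exact: subset_trans ED.
rewrite toE; last by move=> x /dFK ->; rewrite mulr0.
rewrite toE; last by move=> x /FK ->; rewrite mulr0.
have [cv dv cdv] := test_function_C1_dir i tv.
have mv : measurable_fun E v by exact: measurable_continuous_rV.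
have mdv : measurable_fun E (partial i v) by exact: measurable_continuous_rV.
have vC x : E x -> `|v x| <= C' by have [] := HC' x.
have dvC x : E x -> `|partial i v x| <= C' by have [] := HC' x.
have mulb u (c : 'rV[R]_n -> R) : rintegrable leb E u -> measurable_fun E c ->
    (forall x, E x -> `|c x| <= C') -> rintegrable leb E (fun x => u x * c x).
  move=> iu mc cC; apply: (rintegrable_eq mE (f := fun x => c x * u x)).
    by move=> x _; rewrite mulrC.
  exact: (rintegrable_bounded mE mc cC).
have j1 := mulb _ _ iA mdv dvC.
have j2 := mulb _ _ iC mv vC.
have j3 := mulb _ _ iB mv vC.
have -> : \int[leb]_(x in E) (b x * psi x * partial i F x) =
    \int[leb]_(x in E) (b x * psi x * nu x * partial i v x) +
    \int[leb]_(x in E) (b x * psi x * partial i nu x * v x).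
  by rewrite -RintegralD//; apply: eq_Rintegral => x /set_mem Ex; rewrite dF//; ring.
have -> : \int[leb]_(x in E) ((wp i b x * psi x + b x * wp i psi x) * F x) =
    \int[leb]_(x in E) ((wp i b x * psi x + b x * wp i psi x) * nu x * v x).
  by apply: eq_Rintegral => x xE; rewrite /F patchE xE mulrA.
(* The term with [d_i nu] changes sides and joins the two others in [product_partial]. *)
move/(canRL (addrK _)) ->.
rewrite -opprD; congr (- _); rewrite -RintegralD//.
by apply: eq_Rintegral => x _; rewrite /product_partial -mulrDl.
Qed.

(** Group the Leibniz terms by [psi] and [d_i psi]. The coefficients are [b] and [d_i b] times [n_i]
    and [d_i n_i], which are bounded on [E] and cut to zero outside; hence they are square
    integrable on [D]. *)
Lemma weak_div_functional (N : 'rV[R]_n -> 'rV[R]_n) b :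
  (forall i, C1_closure E (fun x => N x ord0 i)) -> H10 D b ->
  exists p (q : 'I_n -> 'rV[R]_n -> R), [/\ sq p, forall i, sq (q i) &
    forall psi, H10 D psi ->
      \int[leb]_(x in E) weak_div E (fun y => (b y * psi y) *: N y) x =
      functional D p q psi].
Proof.
move=> CN Hb; have [H1b _] := Hb; pose nu i x := N x ord0 i.
pose p i x := (partial i (nu i) \_ E) x * b x + (nu i \_ E) x * wp i b x.
pose q i x := (nu i \_ E) x * b x.
have cut (f : 'rV[R]_n -> R) (C : R) : measurable_fun E f -> (forall x, E x -> `|f x| <= C) ->
    measurable_fun D (f \_ E) /\ forall x, D x -> `|(f \_ E) x| <= `|C|.
  move=> mf fC; split.
    by apply/measurable_restrict => //; rewrite setIidr.
  move=> x _; rewrite patchE; case: ifPn => [/set_mem Ex|_]; last by rewrite normr0.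
  by rewrite (le_trans (fC x Ex))// ler_norm.
have sb := H1_sqint oD H1b.
have sq_cut (f : 'rV[R]_n -> R) (C : R) g : measurable_fun E f ->
    (forall x, E x -> `|f x| <= C) -> sq g ->
    sq (fun x => (f \_ E) x * g x).
  by move=> mf fC sg; have [mcf cfC] := cut _ _ mf fC; exact: (sqintM_bounded mD mcf cfC).
have bnd i := C1_closure_bounded bE i (CN i).
have sq_ i : sq (q i).
  have [C HC] := bnd i; apply: (sq_cut _ C) => //.
    exact: (C1_closure_measurable oE (CN i)).
  by move=> x /HC[].
have sp i : sq (p i).
  have [C HC] := bnd i; apply: sqintD => //; apply: (sq_cut _ C) => //.
  - exact: (C1_closure_partial_measurable oE i (CN i)).
  - by move=> x /HC[].
  - exact: (C1_closure_measurable oE (CN i)).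
  - by move=> x /HC[].
  - exact: H1_weak_partial_sqint.
exists (fun x => \sum_(i < n) p i x), q; split => //.
  elim: (index_enum _) => [|i s IH].
    rewrite (_ : (fun x => _) = (fun x => 0 * b x)); first exact: sqintZ.
    by apply/funext => x; rewrite big_nil mul0r.
  rewrite (_ : (fun x => _) = (fun x => p i x + \sum_(j <- s) p j x)).
    exact: sqintD.
  by apply/funext => x; rewrite big_cons.
move=> psi Hpsi; have [H1psi _] := Hpsi.
have W i := weak_partial_product i Hb Hpsi (CN i).
have FE i : (fun y => ((b y * psi y) *: N y) ord0 i) = (fun y => b y * psi y * nu i y).
  by apply/funext => y; rewrite mxE.
have wE i : is_weak_partial E i (fun y => ((b y * psi y) *: N y) ord0 i)
    (weak_partial E i (fun y => ((b y * psi y) *: N y) ord0 i)).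
  by rewrite FE; exact: weak_partialP (W i).2.
have wae i : weak_partial E i (fun y => ((b y * psi y) *: N y) ord0 i) =
    product_partial i b psi (nu i) %[ae leb in E].
  by apply: weak_partial_ae => //; rewrite FE; exact: (W i).2.
have mw i : measurable_fun E (weak_partial E i (fun y => ((b y * psi y) *: N y) ord0 i)).
  by have [_ []] := wE i.
have mpp i : measurable_fun E (product_partial i b psi (nu i)).
  exact: rintegrable_measurable (W i).1.
have iw i : rintegrable leb E (weak_partial E i (fun y => ((b y * psi y) *: N y) ord0 i)).
  apply: (ae_eq_rintegrable mE (mw i)) (W i).1.
  by apply: filterS (wae i) => x + Ex => /(_ Ex) ->.
rewrite /weak_div Rintegral_sum//.
have term i : \int[leb]_(x in E) weak_partial E i (fun y => ((b y * psi y) *: N y) ord0 i) x =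
    ip psi (p i) + ip (wp i psi) (q i).
  rewrite (ae_eq_Rintegral mE (mw i) (mpp i) (wae i)).
  have sps := H1_sqint oD H1psi; have swps := H1_weak_partial_sqint oD i H1psi.
  have -> : \int[leb]_(x in E) product_partial i b psi (nu i) x =
      \int[leb]_(x in D) ((product_partial i b psi (nu i)) \_ E) x.
    by rewrite -Rintegral_mkcondr setIidr.
  rewrite -RintegralD//; try exact: sqintM.
  apply: eq_Rintegral => x _; rewrite /p /q /product_partial !patchE.
  (* Outside [E] a restriction takes the default value [point], which is 0 in [R]. *)
  by case: ifP => _; rewrite -?[point]/(0 : R); ring.
rewrite (eq_bigr _ (fun i _ => term i)) big_split /=; congr (_ + _).
rewrite /ip; transitivity (\int[leb]_(x in D) (\sum_(i < n) psi x * p i x)).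
  by rewrite Rintegral_sum// => i; apply: sqintM => //; exact: H1_sqint.
by apply: eq_Rintegral => x _; rewrite mulr_sumr.
Qed.

End weak_divergence.

(** * The interface problem *)

Lemma open_level_sets (R : realType) (n : nat) (D : set 'rV[R]_n)
    (phi : 'rV[R]_n -> R) : open D -> (forall x, D x -> {for x, continuous phi}) ->
  open (neg_part D phi) /\ open (pos_part D phi).
Proof.
move=> oD cphi; split; rewrite openE => x [Dx phix].
  exact: (filterI (open_nbhs_nbhs (conj oD Dx)) (cvgr_lt _ (cphi x Dx) 0 phix)).
exact: (filterI (open_nbhs_nbhs (conj oD Dx)) (cvgr_gt _ (cphi x Dx) 0 phix)).
Qed.

(** The weak formulation carries a minus sign on the energy; this moves it to the data, so that the
    existence result applies to [-(f + p)] and [-q]. *)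
Lemma functionalN (R : realType) (n : nat) (D : set 'rV[R]_n)
    (p f psi : 'rV[R]_n -> R) (q : 'I_n -> 'rV[R]_n -> R) : open D ->
  sqint (lebesgue_rV R n) D p -> sqint (lebesgue_rV R n) D f ->
  (forall i, sqint (lebesgue_rV R n) D (q i)) -> H1 D psi ->
  functional D (fun x => -1 * (f x + p x)) (fun i x => -1 * q i x) psi =
  - (\int[lebesgue_rV R n]_(x in D) (f x * psi x) + functional D p q psi).
Proof.
move=> oD sp sf sq Hpsi; have mD := open_rV_measurable oD.
have spsi := H1_sqint oD Hpsi; have sfp := sqintD mD sf sp.
rewrite /functional addrA opprD; congr (_ + _).
  rewrite ipC (ipZl mD)// (ipDl mD)// mulN1r.
  by congr (- (_ + _)); rewrite ipC.
rewrite -sumrN; apply: eq_bigr => i _; rewrite ipC (ipZl mD) ?mulN1r 1?ipC//.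
exact: H1_weak_partial_sqint.
Qed.

Theorem theorem2p1 (R : realType) (n : nat) (n_gt0 : (0 < n)%N)
    (Om Omm Omp Gam : set 'rV[R]_n) (phi : 'rV[R]_n -> R)
    (beta : 'rV[R]_n -> 'M[R]_n) (m M : R) (N : 'rV[R]_n -> 'rV[R]_n)
    (f b : 'rV[R]_n -> R)
    (* the domain and the interface *)
    (Om_domain : bounded_smooth_domain Om)
    (phi_smooth : smooth Om phi)
    (OmmE : Omm = neg_part Om phi)
    (OmpE : Omp = pos_part Om phi)
    (GamE : Gam = zero_part Om phi)
    (Gam_smooth : smooth_hypersurface Gam)
    (bdry_Omm : bdry Omm = Gam)
    (phi_signed_dist :
      forall x, Gam x -> \forall y \near x, phi y = signed_dist Gam Omm y)
    (* the coefficient *)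
    (beta_spd : forall x, Om x -> sym_posdef (beta x))
    (beta_C1m : forall i j, C1_closure Omm (fun x => beta x i j))
    (beta_C1p : forall i j, C1_closure Omp (fun x => beta x i j))
    (beta_Gam : forall x, Gam x -> beta @ within Omm (nbhs x) --> beta x)
    (m_gt0 : 0 < m) (m_lt_M : m < M)
    (beta_bounds : forall x, Om x ->
      loewner_le m%:M (beta x) /\ loewner_le (beta x) M%:M)
    (* a C^1 extension of the unit normal to the closure of Omm *)
    (N_C1 : forall i, C1_closure Omm (fun x => N x ord0 i))
    (N_cont : {within closure Omm, continuous N})
    (N_normal : forall x, Gam x ->
      N x = (enorm (grad phi x))^-1 *: grad phi x)
    (f_L2 : L2 Om f)
    (b_H10 : H10 Om b) :
  exists u, weak_solution Om Omm beta N f b u /\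
    forall v, weak_solution Om Omm beta N f b v -> u = v %[ae lebesgue_rV R n in Om].
Proof.
have [_ oOm _ bOm _] := Om_domain.
have cphi x : Om x -> {for x, continuous phi}.
  by have [+ _] := phi_smooth 0%N; exact.
have [oOmm oOmp] := open_level_sets oOm cphi; rewrite -OmmE -OmpE in oOmm oOmp.
have OmmOm : Omm `<=` Om by rewrite OmmE => x [].
have OmpOm : Omp `<=` Om by rewrite OmpE => x [].
have GamOm : Gam `<=` Om by rewrite GamE => x [].
have bounded_sub A : A `<=` Om -> bounded_set A.
  by move=> AOm; case: bOm => r [rr Hr]; exists r; split=> // s /Hr Hs x /AOm /Hs.
have bOmm := bounded_sub _ OmmOm; have bOmp := bounded_sub _ OmpOm.
have clE x : closure Omm x -> Omm x \/ Gam x.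
  move=> cx; have [|nx] := pselect (Omm x); [by left|right].
  by rewrite -bdry_Omm; split => //; rewrite (interior_id _).1.
(* Putting the interface with [Omm] lets the one-sided values of [beta] settle measurability and
   boundedness on all of [Om]. *)
have OmE : Om = closure Omm `|` Omp.
  apply/seteqP; split=> [x Ox|x [/clE[/OmmOm|/GamOm]|/OmpOm]//].
  have [x0|x0|x0] := ltgtP (phi x) 0.
  - by left; apply: subset_closure; rewrite OmmE.
  - by right; rewrite OmpE.
  - by left; have : bdry Omm x by [rewrite bdry_Omm GamE]; case.
(* On the closure of [Omm] the entries agree with their continuous extension by [beta_Gam]; on [Omp]
   they are continuous and bounded. *)
have betaP i j : measurable_fun Om (fun x => beta x i j) /\
    exists C, forall x, Om x -> `|beta x i j| <= C.
  have [|m1 [C1 H1]] := C1_closure_extend oOmm bOmm (beta_C1m i j).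
    move=> x; rewrite bdry_Omm => Gx.
    exact: (cvg_comp _ _ (beta_Gam x Gx) (@coord_continuous R n n i j (beta x))).
  have [_ /(extends_continuously_bounded bOmp)[C2 H2] _] := beta_C1p i j.
  have m2 := C1_closure_measurable oOmp (beta_C1p i j).
  split; first rewrite OmE.
    apply/measurable_funU; last by split.
      by apply: closed_rV_measurable; exact: closed_closure.
    exact: open_rV_measurable.
  exists (Num.max C1 C2) => x; rewrite OmE => -[/H1 h|/H2 h]; rewrite le_max h ?orbT//.
have /choice[C HC] : forall ij : 'I_n * 'I_n, exists C, forall x, Om x ->
    `|beta x ij.1 ij.2| <= C.
  by move=> [i j]; have [] := betaP i j.
(* Summing the bounds of the entries gives one constant for all [i] and [j]. *)
have beta_le i j x : Om x -> `|beta x i j| <= \sum_ij `|C ij|.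
  move=> Ox; rewrite (bigD1 (i, j))//= (le_trans (HC (i, j) x Ox))//.
  by rewrite (le_trans (ler_norm _))// lerDl sumr_ge0.
have beta_m i j : measurable_fun Om (fun x => beta x i j) by have [] := betaP i j.
have beta_sym x : Om x -> (beta x)^T = beta x by move=> /beta_spd[].
have beta_lo x : Om x -> loewner_le m%:M (beta x) by move=> /beta_bounds[].
have beta_up x : Om x -> loewner_le (beta x) M%:M by move=> /beta_bounds[].
have [p [q [sp sq divE]]] := weak_div_functional oOm bOm oOmm OmmOm N_C1 b_H10.
have sf : sqint (lebesgue_rV R n) Om f by exact/(L2P oOm).
have mOm := open_rV_measurable oOm.
(* Both existence and uniqueness are read off this reformulation, in which the interface term has
   become part of the data. *)
have solE u : H10 Om u -> weak_solution Om Omm beta N f b u <->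
    forall psi, H10 Om psi -> energy_form Om beta u psi =
      functional Om (fun x => -1 * (f x + p x)) (fun i x => -1 * q i x) psi.
  move=> Hu; have [H1u _] := Hu.
  have eqE psi : H10 Om psi ->
      - (\int[lebesgue_rV R n]_(x in Om)
           dotv (actv (beta x) (weak_grad Om u x)) (weak_grad Om psi x)) =
      (\int[lebesgue_rV R n]_(x in Om) (f x * psi x)) +
      (\int[lebesgue_rV R n]_(x in Omm)
         weak_div Omm (fun y => (b y * psi y) *: N y) x) <->
      energy_form Om beta u psi =
      functional Om (fun x => -1 * (f x + p x)) (fun i x => -1 * q i x) psi.
    move=> Hpsi; have [H1psi _] := Hpsi.
    rewrite functionalN// (energy_formE oOm beta_m beta_le H1u H1psi) divE//.
    by split=> [<-|->]; rewrite opprK.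
  split=> [[_ su] psi Hpsi|su]; first by apply/eqE => //; exact: su.
  by split=> // psi Hpsi; apply/eqE => //; exact: su.
have sp' : sqint (lebesgue_rV R n) Om (fun x => -1 * (f x + p x)).
  by apply: sqintZ => //; exact: sqintD.
have sq' i : sqint (lebesgue_rV R n) Om (fun x => -1 * q i x) by exact: sqintZ.
have [u Hu uE] := energy_form_solution oOm bOm n_gt0 m_gt0 beta_sym beta_m beta_le
  beta_lo beta_up sp' sq'.
exists u; split; first exact/solE.
move=> v sv; have [Hv _] := sv.
exact: (energy_form_unique oOm bOm n_gt0 m_gt0 beta_m beta_le beta_lo Hu Hv
  uE ((solE v Hv).1 sv)).
Qed.
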